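(* Let $M$ be a 7-dimensional manifold with a nearly parallel $G_2$ structure $\varphi$, let $\xi$ be a unit vector field on $M$, and let $(\phi,\xi,\eta,g)$ be the almost contact metric structure obtained from $\varphi$ and $\xi$. Then $\nabla_\xi\xi=0$ if and only if $M$ (with this almost contact metric structure) is almost K-contact.
   Context: **$G_2$ structures.** On $\mathbb{R}^7$ with dual basis $e^1,\dots,e^7$ put $\varphi_0=e^{123}+e^{145}+e^{167}+e^{246}-e^{257}-e^{347}-e^{356}$, where $e^{ijk}=e^i\wedge e^j\wedge e^k$. A $G_2$ structure on an oriented 7-manifold $M$ is a global 3-form $\varphi$ such that for each $p\in M$ there is a linear isomorphism $T_pM\cong\mathbb{R}^7$ carrying $\varphi_p$ to $\varphi_0$. It determines a Riemannian metric $g$ and an orientation (those of $\mathbb{R}^7$ under such isomorphisms) and a 2-fold vector cross product $\times$ defined by $\varphi(x,y,z)=g(x\times y,z)$. $\nabla$ is the Levi-Civita connection of $g$. The $G_2$ structure is nearly parallel if $d\varphi=k\ast\varphi$ for some constant $k$, with $\ast$ the Hodge star. **Induced almost contact metric structure.** For a unit vector field $\xi$ on $M$ put $\phi(x)=\xi\times x$, $\eta(x)=g(\xi,x)$. Then $(\phi,\xi,\eta,g)$ is an almost contact metric structure: $\phi^2=-I+\eta\otimes\xi$, $\eta(\xi)=1$, $g(\phi x,\phi y)=g(x,y)-\eta(x)\eta(y)$. An almost contact metric manifold is almost K-contact if $\nabla_\xi\phi=0$, where $(\nabla_\xi\phi)(x)=\nabla_\xi(\phi x)-\phi(\nabla_\xi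 x)$.
   Formalization: If the constant k in dφ = k∗φ is 0, ''nearly parallel'' is taken to require also d∗φ = 0 (so φ is parallel); with dφ = 0 alone the claim fails, e.g. on a nilpotent group with de^1=e^34, de^2=-e^37 and ξ=e_1. *)

(* Defs.v *)
(* Smooth manifolds are given by smooth atlases and tensor
   fields by their components in the charts, subject to the usual change of
   chart rules. Tangent vectors are row vectors: the differential of f at x
   sends v to v *m 'J f x, and the i-th row of a frame matrix is its i-th
   vector. *)
From HB Require Import structures.
From mathcomp Require Import all_boot all_order all_algebra all_fingroup.
From mathcomp Require Import boolp classical_sets reals topology normedtype derive.
From mathcomp Require Import ring.
Set Implicit Arguments.
Unset Strict Implicit.
Unset Printing Implicit Defensive.
Import Order.TTheory GRing.Theory Num.Theory.
Import numFieldNormedType.Exports.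
Local Open Scope classical_set_scope.
Local Open Scope ring_scope.

Section Smoothness.
Context {R : realType} {n : nat}.
Implicit Types (f : 'rV[R]_n -> R) (V : set 'rV[R]_n).

Definition partial (i : 'I_n) f (x : 'rV[R]_n) : R := 'D_(delta_mx 0 i) f x.

(* C^infinity: partial derivatives of all orders exist and are continuous;
   meaningful for V open. *)
Definition smooth_on V f : Prop :=
  forall (s : seq 'I_n) (x : 'rV[R]_n), V x ->
    {for x, continuous (foldr partial f s)} /\
    forall i, derivable (foldr partial f s) x (delta_mx 0 i).

End Smoothness.

Record chart (R : realType) (n : nat) (M : topologicalType) := Chart {
  chart_dom : set M;
  chart_map :> M -> 'rV[R]_n;
  chart_inv : 'rV[R]_n -> M;
  chart_dom_open : open chart_dom;
  chart_img_open : open (chart_map @` chart_dom);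
  chart_mapK : forall p, chart_dom p -> chart_inv (chart_map p) = p;
  chart_map_cont : {within chart_dom, continuous chart_map};
  chart_inv_cont : {within chart_map @` chart_dom, continuous chart_inv} }.

Definition chart_img (R : realType) (n : nat) (M : topologicalType)
  (a : chart R n M) : set 'rV[R]_n := a @` chart_dom a.

Definition overlap (R : realType) (n : nat) (M : topologicalType)
  (a b : chart R n M) : set 'rV[R]_n := a @` (chart_dom a `&` chart_dom b).

Definition transition (R : realType) (n : nat) (M : topologicalType)
  (a b : chart R n M) (x : 'rV[R]_n) : 'rV[R]_n := b (chart_inv a x).

Record manifold (R : realType) (n : nat) := Manifold {
  mfd_carrier :> topologicalType;
  mfd_hausdorff : hausdorff_space mfd_carrier;
  mfd_second_countable : @second_countable mfd_carrier;
  atlas_index : Type;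
  atlas : atlas_index -> chart R n mfd_carrier;
  atlas_cover : forall p : mfd_carrier, exists a, chart_dom (atlas a) p;
  atlas_smooth : forall (a b : atlas_index) (j : 'I_n),
    smooth_on (overlap (atlas a) (atlas b))
      (fun x => transition (atlas a) (atlas b) x 0 j) }.

(* A p-form at a point is given by its components w(e_(I 0),...,e_(I (p-1))) on
   the basis vectors, for all multi-indices I, increasing or not. *)
Section Multilinear.
Context {R : realType} {n : nat}.

Definition dot (G : 'M[R]_n) (u v : 'rV[R]_n) : R := (u *m G *m v^T) 0 0.

Definition form_eval (p : nat) (w : {ffun 'I_p -> 'I_n} -> R)
    (v : 'I_p -> 'rV[R]_n) : R :=
  \sum_(I : {ffun 'I_p -> 'I_n}) w I * \prod_(k < p) v k 0 (I k).

Definition alternating (p : nat) (w : {ffun 'I_p -> 'I_n} -> R) : Prop :=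
  forall (I : {ffun 'I_p -> 'I_n}) (s : 'S_p),
    w [ffun k => I (s k)] = (-1) ^+ s * w I.

Definition basis_rows (p : nat) (I : {ffun 'I_p -> 'I_n}) : 'M[R]_(p, n) :=
  \matrix_(k, j) (I k == j)%:R.

(* components of e^(I 0) /\ ... /\ e^(I (p-1)) *)
Definition basis_form (p : nat) (I J : {ffun 'I_p -> 'I_n}) : R :=
  \det (basis_rows I *m (basis_rows J)^T).

End Multilinear.

Section Tensors.
Context {R : realType} {n : nat}.

Record vector_field (M : manifold R n) := VectorField {
  vf :> atlas_index M -> 'rV[R]_n -> 'rV[R]_n;
  vf_smooth : forall a (k : 'I_n),
    smooth_on (chart_img (atlas a)) (fun x => vf a x 0 k);
  vf_change : forall a b x, overlap (atlas a) (atlas b) x ->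
    let t := transition (atlas a) (atlas b) in
    vf b (t x) = vf a x *m 'J t x }.

Record diff_form (p : nat) (M : manifold R n) := DiffForm {
  df :> atlas_index M -> 'rV[R]_n -> {ffun 'I_p -> 'I_n} -> R;
  df_smooth : forall a (I : {ffun 'I_p -> 'I_n}),
    smooth_on (chart_img (atlas a)) (fun x => df a x I);
  df_alt : forall a x, chart_img (atlas a) x -> alternating (df a x);
  df_change : forall a b x, overlap (atlas a) (atlas b) x ->
    let t := transition (atlas a) (atlas b) in
    forall I, df a x I = form_eval (df b (t x)) (fun k => row (I k) ('J t x)) }.

Record riemannian_metric (M : manifold R n) := RiemannianMetric {
  rm :> atlas_index M -> 'rV[R]_n -> 'M[R]_n;
  rm_smooth : forall a (i j : 'I_n),
    smooth_on (chart_img (atlas a)) (fun x => rm a x i j);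
  rm_sym : forall a x, chart_img (atlas a) x -> (rm a x)^T = rm a x;
  rm_pos : forall a x, chart_img (atlas a) x ->
    forall v, v != 0 -> 0 < dot (rm a x) v v;
  rm_change : forall a b x, overlap (atlas a) (atlas b) x ->
    let t := transition (atlas a) (atlas b) in
    rm a x = 'J t x *m rm b (t x) *m ('J t x)^T }.

(* or_sign a x is 1 if the coordinate basis of the chart a is positively
   oriented at x, and -1 otherwise *)
Record orientation (M : manifold R n) := Orientation {
  or_sign :> atlas_index M -> 'rV[R]_n -> R;
  or_unit : forall a x, chart_img (atlas a) x ->
    or_sign a x = 1 \/ or_sign a x = -1;
  or_cont : forall a x, chart_img (atlas a) x ->
    {for x, continuous (or_sign a)};
  or_change : forall a b x, overlap (atlas a) (atlas b) x ->
    let t := transition (atlas a) (atlas b) in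
    or_sign a x = Num.sg (\det ('J t x)) * or_sign b (t x) }.

End Tensors.

Section LeviCivita.
Context {R : realType} {n : nat}.

(* Gamma_(ij)^k of a metric in one chart; the Levi-Civita property is the
   content of christoffel_torsion_free, christoffel_metric and
   christoffel_unique *)
Definition christoffel (g : 'rV[R]_n -> 'M[R]_n) (x : 'rV[R]_n)
    (i j k : 'I_n) : R :=
  \sum_l (partial i (fun y => g y j l) x + partial j (fun y => g y i l) x
          - partial l (fun y => g y i j) x) / 2 * invmx (g x) l k.

(* nabla_X Y in one chart *)
Definition covariant (g : 'rV[R]_n -> 'M[R]_n) (X Y : 'rV[R]_n -> 'rV[R]_n)
    (x : 'rV[R]_n) : 'rV[R]_n :=
  \row_k (\sum_i X x 0 i * partial i (fun y => Y y 0 k) x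
          + \sum_i \sum_j christoffel g x i j k * X x 0 i * Y x 0 j).

Lemma dot_pos_unit (G : 'M[R]_n) :
  (forall v, v != 0 -> 0 < dot G v v) -> G \in unitmx.
Proof.
move=> Gpos; rewrite -row_free_unit -kermx_eq0; apply/rowV0P => v /sub_kermxP vG.
apply/eqP; apply: contraT => /Gpos.
by rewrite /dot vG mul0mx mxE ltxx.
Qed.

Variables (M : manifold R n) (g : riemannian_metric M) (a : atlas_index M).
Variables (x : 'rV[R]_n) (ax : chart_img (atlas a) x).

Let d (i j l : 'I_n) : R := partial i (fun y => g a y j l) x.

Let dC i j l : d i j l = d i l j.
Proof.
rewrite /d /partial; apply: near_eq_derive.
have /open_nbhs_nbhs : open_nbhs x (chart_img (atlas a)).
  by split=> //; exact: chart_img_open.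
by apply: filterS => y /rm_sym Gs; rewrite -[in LHS]Gs mxE.
Qed.

Let g_unit : g a x \in unitmx.
Proof. by apply: dot_pos_unit; exact: rm_pos. Qed.

Lemma christoffel_torsion_free i j k :
  christoffel (g a) x i j k = christoffel (g a) x j i k.
Proof.
apply: eq_bigr => l _; rewrite -!/(d _ _ _) (dC l i j).
by rewrite (addrC (d i j l)).
Qed.

Let lower (C : 'I_n -> R) l : \sum_k (\sum_m C m * invmx (g a x) m k) * g a x k l
  = C l.
Proof.
transitivity (((\row_m C m) *m invmx (g a x) *m g a x) 0 l).
  rewrite [RHS]mxE; apply: eq_bigr => k _; rewrite mxE; congr (_ * _).
  by apply: eq_bigr => m _; rewrite mxE.
by rewrite mulmxKV // mxE.
Qed.

Let raise (C : 'I_n -> R) l : \sum_k (\sum_m C m * g a x m k) * invmx (g a x) k l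
  = C l.
Proof.
transitivity (((\row_m C m) *m g a x *m invmx (g a x)) 0 l).
  rewrite [RHS]mxE; apply: eq_bigr => k _; rewrite mxE; congr (_ * _).
  by apply: eq_bigr => m _; rewrite mxE.
by rewrite mulmxK // mxE.
Qed.

Lemma christoffel_metric m i j :
  partial m (fun y => g a y i j) x =
  \sum_k christoffel (g a) x m i k * g a x k j
  + \sum_k christoffel (g a) x m j k * g a x i k.
Proof.
rewrite -/(d m i j).
have gC p q : g a x p q = g a x q p by rewrite -[in LHS](rm_sym g ax) mxE.
under [X in _ + X]eq_bigr => k _ do rewrite (gC i k).
rewrite !lower -!/(d _ _ _) (dC j m i) (dC i m j) (dC m j i).
by field.
Qed.

Lemma christoffel_unique (C : 'I_n -> 'I_n -> 'I_n -> R) :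
  (forall i j k, C i j k = C j i k) ->
  (forall m i j, partial m (fun y => g a y i j) x =
     \sum_k C m i k * g a x k j + \sum_k C m j k * g a x i k) ->
  forall i j k, C i j k = christoffel (g a) x i j k.
Proof.
move=> Csym Cmet i j k.
have gC p q : g a x p q = g a x q p by rewrite -[in LHS](rm_sym g ax) mxE.
pose c p q r := \sum_s C p q s * g a x s r.
have cC p q r : c p q r = c q p r by apply: eq_bigr => s _; rewrite Csym.
have dE p q r : d p q r = c p q r + c p r q.
  rewrite /d Cmet; congr (_ + _).
  by apply: eq_bigr => s _; rewrite (gC q s).
rewrite -[LHS](raise (C i j)); apply: eq_bigr => l _; congr (_ * _).
rewrite -!/(d _ _ _) !dE -/(c i j l) (cC j i l) (cC j l i) (cC i l j).
by field.
Qed.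

End LeviCivita.

Section ExteriorCalculus.
Context {R : realType}.

(* (d w)_I = sum_k (-1)^k d/dx^(I k) of w_(I without its k-th index) *)
Definition ext_d (n p : nat) (w : 'rV[R]_n -> {ffun 'I_p -> 'I_n} -> R)
    (x : 'rV[R]_n) (I : {ffun 'I_p.+1 -> 'I_n}) : R :=
  \sum_(k < p.+1)
    (-1) ^+ k * partial (I k) (fun y => w y [ffun m => I (lift k m)]) x.

(* Hodge star at a point, for the metric G and the orientation sign s:
   ( * w)_J = s sqrt(det G) / p! sum_I w^I eps_(IJ), so that on an oriented
   orthonormal basis w /\ * w = |w|^2 e^(1...n). *)
Definition hodge (p q : nat) (s : R) (G : 'M[R]_(p + q))
    (w : {ffun 'I_p -> 'I_(p + q)} -> R) (J : {ffun 'I_q -> 'I_(p + q)}) : R :=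
  s * Num.sqrt (\det G) / p`!%:R *
  \sum_(I : {ffun 'I_p -> 'I_(p + q)})
    form_eval w (fun k => row (I k) (invmx G)) *
    \det (col_mx (basis_rows I) (basis_rows J)).

End ExteriorCalculus.

Section G2.
Context {R : realType}.

(* e^(ijk) on R^7, with indices from 1 to 7 *)
Definition e3 (i j k : nat) : {ffun 'I_3 -> 'I_7} -> R :=
  basis_form [ffun m => inord (tnth [tuple i; j; k] m).-1].

Definition g2_model (I : {ffun 'I_3 -> 'I_7}) : R :=
  e3 1 2 3 I + e3 1 4 5 I + e3 1 6 7 I + e3 2 4 6 I
  - e3 2 5 7 I - e3 3 4 7 I - e3 3 5 6 I.

(* The rows of A form a basis in which w has the components of the model form,
   that is, v |-> v *m A is an isomorphism from R^7 taking the model to w. *)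
Definition adapted_frame (w : {ffun 'I_3 -> 'I_7} -> R) (A : 'M[R]_7) : Prop :=
  A \in unitmx /\
  forall I : {ffun 'I_3 -> 'I_7},
    form_eval w (fun k => row (I k) A) = g2_model I.

(* A G2 structure together with the metric and the orientation it determines:
   adapted frames are orthonormal and positively oriented. *)
Record g2_structure (M : manifold R 7) := G2Structure {
  g2_form : diff_form 3 M;
  g2_metric : riemannian_metric M;
  g2_orient : orientation M;
  g2_adapted : forall a x, chart_img (atlas a) x ->
    exists A, adapted_frame (g2_form a x) A;
  g2_metricP : forall a x, chart_img (atlas a) x ->
    forall A, adapted_frame (g2_form a x) A -> A *m g2_metric a x *m A^T = 1%:M;
  g2_orientP : forall a x, chart_img (atlas a) x ->
    forall A, adapted_frame (g2_form a x) A -> 0 < g2_orient a x * \det A }.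

Variables (M : manifold R 7) (S : g2_structure M).

Definition g2_star (a : atlas_index M) (x : 'rV[R]_7)
    (J : {ffun 'I_4 -> 'I_7}) : R :=
  @hodge R 3 4 (g2_orient S a x) (g2_metric S a x) (g2_form S a x) J.

(* d phi = k * phi with k constant. For k <> 0 the form * phi is automatically
   closed; for k = 0 this has to be required (it makes the structure parallel),
   as d phi = 0 alone only defines closed G2 structures, which are not of
   nearly parallel type. *)
Definition nearly_parallel : Prop :=
  exists k : R,
    (forall a x, chart_img (atlas a) x ->
       forall J, ext_d (g2_form S a) x J = k * g2_star a x J) /\
    (k = 0 -> forall a x, chart_img (atlas a) x ->
       forall J, ext_d (g2_star a) x J = 0).

(* u x v at a point, for the metric G and the 3-form w *)
Definition cross (G : 'M[R]_7) (w : {ffun 'I_3 -> 'I_7} -> R)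
    (u v : 'rV[R]_7) : 'rV[R]_7 :=
  (\row_c form_eval w (tnth [tuple u; v; delta_mx 0 c])) *m invmx G.

Lemma crossP (G : 'M[R]_7) (w : {ffun 'I_3 -> 'I_7} -> R) (u v z : 'rV[R]_7) :
  G \in unitmx -> form_eval w (tnth [tuple u; v; z]) = dot G (cross G w u v) z.
Proof.
move=> Gu; rewrite /dot /cross mulmxKV // mxE.
have prod3 (I : {ffun 'I_3 -> 'I_7}) y :
    \prod_(k < 3) tnth [tuple u; v; y] k 0 (I k) =
    u 0 (I ord0) * v 0 (I (lift ord0 ord0)) * y 0 (I (lift ord0 (lift ord0 ord0))).
  by rewrite !big_ord_recl big_ord0 mulr1 !(tnth_nth 0) /= mulrA.
under eq_bigr => c _ do rewrite !mxE big_distrl /=.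
rewrite exchange_big /=; apply: eq_bigr => I _; rewrite prod3.
rewrite (bigD1 (I (lift ord0 (lift ord0 ord0)))) //= prod3 !mxE !eqxx mulr1.
rewrite [X in _ + X]big1 ?addr0 -?mulrA // => c /negPf cI.
by rewrite prod3 !mxE eqxx [_ == c]eq_sym cI !(mulr0, mul0r).
Qed.

End G2.

Section AlmostContact.
Context {R : realType} {n : nat}.
Variables (M : manifold R n) (g : riemannian_metric M) (xi : vector_field M).
Variable phi : atlas_index M -> 'rV[R]_n -> 'rV[R]_n -> 'rV[R]_n.
Variable eta : atlas_index M -> 'rV[R]_n -> 'rV[R]_n -> R.

Definition unit_field : Prop :=
  forall a x, chart_img (atlas a) x -> dot (g a x) (xi a x) (xi a x) = 1.

Definition almost_contact_metric : Prop :=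
  forall a x, chart_img (atlas a) x ->
  [/\ forall v, phi a x (phi a x v) = - v + eta a x v *: xi a x,
      eta a x (xi a x) = 1 &
      forall u v, dot (g a x) (phi a x u) (phi a x v) =
                  dot (g a x) u v - eta a x u * eta a x v].

(* nabla_xi xi = 0 *)
Definition geodesic_field : Prop :=
  forall a x, chart_img (atlas a) x -> covariant (g a) (xi a) (xi a) x = 0.

Definition almost_K_contact : Prop :=
  almost_contact_metric /\
  forall (X : vector_field M) a x, chart_img (atlas a) x ->
    covariant (g a) (xi a) (fun y => phi a y (X a y)) x
    - phi a x (covariant (g a) (xi a) (X a) x) = 0.

End AlmostContact.

Section Induced.
Context {R : realType}.
Variables (M : manifold R 7) (S : g2_structure M) (xi : vector_field M).

Definition induced_phi (a : atlas_index M) (x v : 'rV[R]_7) : 'rV[R]_7 :=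
  cross (g2_metric S a x) (g2_form S a x) (xi a x) v.

Definition induced_eta (a : atlas_index M) (x v : 'rV[R]_7) : R :=
  dot (g2_metric S a x) (xi a x) v.

End Induced.

(* Main.v *)
Require Import Defs.
From mathcomp Require Import all_boot all_order all_algebra all_fingroup.
From mathcomp Require Import boolp classical_sets reals topology normedtype derive.
From mathcomp Require Import ring lra.
Set Implicit Arguments.
Unset Strict Implicit.
Unset Printing Implicit Defensive.
Import Order.TTheory GRing.Theory Num.Theory.
Import numFieldNormedType.Exports.
Local Open Scope classical_set_scope.
Local Open Scope ring_scope.

(** The covariant derivative of the 3-form phi of a nearly parallel G2 structure
    is nabla phi = (k / 4) psi, where psi = * phi. In particular
    (nabla_xi phi)(xi, X, .) = (k / 4) psi(xi, xi, X, .) = 0, and since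
    g(u x v, z) = phi(u, v, z), the Leibniz rule leaves
      nabla_xi (xi x X) - xi x nabla_xi X = (nabla_xi xi) x X
    (covariant_cross). So nabla_xi xi = 0 implies that the field of endomorphisms
    X |-> xi x X is parallel along xi. Conversely, take X = xi: then
    n = nabla_xi xi satisfies n x xi = 0, and it is orthogonal to xi because xi is
    a unit field, so n = - xi x (xi x n) = 0.

    The formula for nabla phi is proved at each point of a chart. The 4-form
      psi(u, v, y, z) = <u x v, y x z> - <u, y><v, z> + <u, z><v, y>
    is alternating and equal to * phi. As the metric is parallel, it follows that
      (nabla_p psi)(u, v, y, z)
        = (nabla_p phi)(u, v, y x z) + (nabla_p phi)(y, z, u x v),
    and that this is again alternating in u, v, y, z. As the connection is torsion
    free, d phi and d psi are the alternations of nabla phi and nabla psi. Hence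
    d phi = k psi and d psi = 0 (a hypothesis if k = 0, and otherwise a consequence
    of d d phi = 0, which is Schwarz's theorem) are linear equations on nabla phi.

    These equations are solved in an adapted frame e_1, ..., e_7 (nabla_psi_frame).
    With the labels read as the nonzero vectors of F_2^3, e_i x e_j is plus or
    minus e_(i + j), so that all equations are sparse and split by degree. That
    nabla_p psi is alternating gives nabla_p phi = psi(T_p, ., ., .) for a
    matrix T, the equation d psi = 0 makes T symmetric, and d phi = k psi makes it
    k / 4 times the identity. *)

(** * The octonion multiplication table *)

(** None stands for 0, Some true for 1 and Some false for -1: tables with such
    entries evaluate by computation. *)
Definition sign3 := option bool.

Definition sgn (T : pzRingType) (s : sign3) : T :=
  match s with None => 0 | Some true => 1 | Some false => -1 end.

Definition sgn_mul (s s' : sign3) : sign3 :=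
  match s, s' with Some a, Some b => Some (a == b) | _, _ => None end.

Lemma sgnN (T : pzRingType) s : sgn T (omap negb s) = - sgn T s.
Proof. by case: s => [[]|] /=; rewrite ?opprK ?oppr0. Qed.

Lemma sgnM (T : pzRingType) s s' : sgn T (sgn_mul s s') = sgn T s * sgn T s'.
Proof.
by case: s s' => [[]|] [[]|] /=; rewrite ?mulr0 ?mul0r ?mul1r ?mulrNN ?mulr1.
Qed.

(** Bitwise exclusive or on 3-bit numbers. The labels 1, ..., 7 are read as the
    nonzero vectors of F_2^3; the seven triples of the model 3-form are then the
    lines of the Fano plane, that is, the triples of sum 0. *)
Definition xor3 (i j : nat) : nat :=
  (nth 0 (nth [::] [:: [:: 0; 1; 2; 3; 4; 5; 6; 7];
    [:: 1; 0; 3; 2; 5; 4; 7; 6];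
    [:: 2; 3; 0; 1; 6; 7; 4; 5];
    [:: 3; 2; 1; 0; 7; 6; 5; 4];
    [:: 4; 5; 6; 7; 0; 1; 2; 3];
    [:: 5; 4; 7; 6; 1; 0; 3; 2];
    [:: 6; 7; 4; 5; 2; 3; 0; 1];
    [:: 7; 6; 5; 4; 3; 2; 1; 0]] i) j)%N.

Local Notation "i ^^ j" := (xor3 i j) (at level 50, left associativity) : nat_scope.
Local Notation rng i := (0 < i < 8)%N.

(** e_i x e_j = cross_sign i j e_(i ^^ j) in an adapted frame e_1, ..., e_7. *)
Definition cross_sign (i j : nat) : sign3 :=
  let o := None in let p := Some true in let n := Some false in
  nth o (nth [::] [:: [:: o; o; o; o; o; o; o; o];
    [:: o; o; p; n; p; n; p; n];
    [:: o; n; o; p; p; n; n; p];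
    [:: o; p; n; o; n; n; p; p];
    [:: o; n; n; p; o; p; p; n];
    [:: o; p; p; p; n; o; n; n];
    [:: o; n; p; n; n; p; o; p];
    [:: o; p; n; n; p; p; n; o]] i) j.

(** The component of the dual 4-form psi on e_l, e_i, e_j, e_k, where
    l = i ^^ j ^^ k is the only index for which it can be nonzero. *)
Definition psi_sign (i j k : nat) : sign3 :=
  if (i == j) || (i == k) then None
  else sgn_mul (cross_sign (i ^^ j ^^ k) i) (cross_sign j k).

Definition psi_sign4 (i j m n : nat) : sign3 :=
  if i == j ^^ m ^^ n then psi_sign j m n else None.

Lemma rng_iota m : rng m = (m \in iota 1 7).
Proof. by rewrite mem_iota. Qed.

Lemma all_rng2 (P : nat -> nat -> bool) :
  all (fun i => all (P i) (iota 1 7)) (iota 1 7) ->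
  forall i j, rng i -> rng j -> P i j.
Proof. by move=> /allP Pr i j; rewrite !rng_iota => /Pr/allP Pi /Pi. Qed.

Lemma all_rng3 (P : nat -> nat -> nat -> bool) :
  all (fun i => all (fun j => all (P i j) (iota 1 7)) (iota 1 7)) (iota 1 7) ->
  forall i j k, rng i -> rng j -> rng k -> P i j k.
Proof.
by move=> /allP Pr i j k; rewrite !rng_iota => /Pr/allP Pi /Pi/allP Pj /Pj.
Qed.

Lemma xor3_rng i j : rng i -> rng j -> cross_sign i j = None \/ rng (i ^^ j).
Proof.
move=> ri rj; apply/predU1P; move: i j ri rj.
exact: (@all_rng2 (fun i j => (cross_sign i j == None) || rng (i ^^ j))).
Qed.

Lemma psi_signC i j k : rng i -> rng j -> rng k ->
  [&& psi_sign i j k == omap negb (psi_sign j i k), i ^^ j ^^ k == j ^^ i ^^ k,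
      psi_sign i j k == omap negb (psi_sign i k j) & i ^^ j ^^ k == i ^^ k ^^ j].
Proof.
by move: i j k; apply: (all_rng3 (P := fun i j k => [&& psi_sign i j k == _,
  _ == j ^^ i ^^ k, psi_sign i j k == _ & _ == i ^^ k ^^ j])).
Qed.

(** * Linear algebra of the covariant derivative in an adapted frame *)

Section FrameAlgebra.
Variable R : realType.
Local Notation cs i j := (sgn R (cross_sign i j)).

(** A 3-form b such that b(u, v, u x z) + b(u, z, u x v) = 0 is of the form
    psi(T, ., ., .): it lies in the 7-dimensional summand of the space of
    3-forms. The hypothesis respects the grading of triples by i ^^ j ^^ k and
    has two terms on frame vectors. In degree 0 it says that b vanishes on the
    lines; in degree l <> 0 it relates any two of the four triples of that
    degree, which leaves one free parameter T_l. *)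
Lemma psi_contraction (b : nat -> nat -> nat -> R) :
  (forall i j k, b i j k = - b j i k) ->
  (forall i j k, b i j k = - b i k j) ->
  (forall i j k, rng i -> rng j -> rng k ->
     cs i k * b i j (i ^^ k)%N + cs i j * b i k (i ^^ j)%N = 0) ->
  exists t : nat -> R, forall i j k, rng i -> rng j -> rng k ->
    b i j k = sgn R (psi_sign i j k) * t (i ^^ j ^^ k)%N.
Proof.
move=> b12 b23 b_cross.
(* T_l is read off on a triple chosen in each degree l; entry 0 is a dummy. *)
pose base := nth (0, 0, 0)%N [:: (0, 0, 0); (2, 4, 7); (1, 4, 7); (1, 4, 6);
  (1, 2, 7); (1, 2, 6); (1, 2, 5); (1, 2, 4)]%N.
pose t l := let: (i, j, k) := base l in sgn R (psi_sign i j k) * b i j k.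
exists t; pose rhs i j k := sgn R (psi_sign i j k) * t (i ^^ j ^^ k)%N.
have perms i j k : [/\ b j i k = - b i j k, b i k j = - b i j k,
    b k j i = - b i j k, b j k i = b i j k & b k i j = b i j k].
  have := b12 i j k; have := b23 i j k; have := b12 i k j.
  by have := b23 j i k; have := b23 k i j => *; split; lra.
have sorted i j k : (i < j < k)%N -> rng i -> rng j -> rng k ->
    b i j k = rhs i j k.
  rewrite {}/rhs => + /andP[+ +] /andP[+ +] /andP[+ +].
  case: i => [|[|[|[|[|[|[|[|i]]]]]]]] //;
    case: j => [|[|[|[|[|[|[|[|j]]]]]]]] //;
    case: k => [|[|[|[|[|[|[|[|k]]]]]]]] //= *;
    match goal with |- b ?i ?j ?k = _ =>
      have := b_cross i j (i ^^ k)%N isT isT isT;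
      have := b_cross j k (j ^^ i)%N isT isT isT;
      have := b_cross k i (k ^^ j)%N isT isT isT;
      have := perms i j k;
      let l := constr:(base (i ^^ j ^^ k)%N) in
      have := perms l.1.1 l.1.2 l.2 end;
    rewrite /t /=; move=> [? ? ? ? ?] [? ? ? ? ?] ? ? ?; lra.
have rhs12 i j k : rng i -> rng j -> rng k -> rhs i j k = - rhs j i k.
  move=> ri rj rk; have /and3P[/eqP E /eqP X _] := psi_signC ri rj rk.
  by rewrite /rhs E X sgnN mulNr.
have rhs23 i j k : rng i -> rng j -> rng k -> rhs i j k = - rhs i k j.
  move=> ri rj rk; have /and4P[_ _ /eqP E /eqP X] := psi_signC ri rj rk.
  by rewrite /rhs E X sgnN mulNr.
have sw12 i j k : rng i -> rng j -> rng k ->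
    b j i k = rhs j i k -> b i j k = rhs i j k.
  by move=> ri rj rk E; rewrite b12 E rhs12 ?opprK.
have sw23 i j k : rng i -> rng j -> rng k ->
    b i k j = rhs i k j -> b i j k = rhs i j k.
  by move=> ri rj rk E; rewrite b23 E rhs23 ?opprK.
have le_sorted i j k : (i <= j <= k)%N -> rng i -> rng j -> rng k ->
    b i j k = rhs i j k.
  case/andP; rewrite leq_eqVlt => /predU1P[<-|lt_ij] le_jk ri rj rk.
    by have := b12 i i k; have := rhs12 i i k ri ri rk; lra.
  move: le_jk; rewrite leq_eqVlt => /predU1P[<-|lt_jk].
    by have := b23 i j j; have := rhs23 i j j ri rj rj; lra.
  by apply: sorted; rewrite ?lt_ij.
move=> i j k ri rj rk; rewrite -/(rhs i j k).
have [ij|/ltnW ji] := leqP i j; have [jk|/ltnW kj] := leqP j k;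
  have [ik|/ltnW ki] := leqP i k.
- by rewrite le_sorted ?ij.
- by rewrite le_sorted ?ij.
- by apply/sw23/le_sorted; rewrite ?ik.
- by apply/sw23/sw12/le_sorted; rewrite ?ki.
- by apply/sw12/le_sorted; rewrite ?ji.
- by apply/sw12/sw23/le_sorted; rewrite ?jk.
- by apply/sw12/sw23/sw12/le_sorted; rewrite ?kj.
- by apply/sw12/sw23/sw12/le_sorted; rewrite ?kj.
Qed.

(** With b_p standing for nabla_p phi, the two alternation hypotheses are
    d phi = k psi and d psi = 0. Writing b_p = psi(T_p, ., ., .), the second one
    is tau /\ phi = 0 for the skew part tau of T, which forces tau = 0, and the
    first one then makes T a multiple of the metric. Both systems split by the
    degree d = p ^^ q of the entries T_pq: for d <> 0, three equations of the
    second system and four of the first one involve the six entries of degree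
    d; the diagonal of T enters the seven remaining equations of the first. *)
Lemma nabla_psi_frame (b : nat -> nat -> nat -> nat -> R) (k : R) :
  let db p i j m n := cs m n * b p i j (m ^^ n)%N + cs i j * b p m n (i ^^ j)%N in
  (forall p i j k, b p i j k = - b p j i k) ->
  (forall p i j k, b p i j k = - b p i k j) ->
  (forall p i j k, rng p -> rng i -> rng j -> rng k ->
     cs i k * b p i j (i ^^ k)%N + cs i j * b p i k (i ^^ j)%N = 0) ->
  (forall i j m n, rng i -> rng j -> rng m -> rng n ->
     b i j m n - b j i m n + b m i j n - b n i j m
     = k * sgn R (psi_sign4 i j m n)) ->
  (forall p i j m n, rng p -> rng i -> rng j -> rng m -> rng n ->
     db p i j m n - db i p j m n + db j p i m n - db m p i j n + db n p i j m
     = 0) ->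
  forall p i j m, rng p -> rng i -> rng j -> rng m ->
  b p i j m = k / 4 * sgn R (psi_sign4 p i j m).
Proof.
move=> db b12 b23 b_cross dphi dpsi.
have /choice[t tP] : forall p, exists t : nat -> R, rng p ->
    forall i j k, rng i -> rng j -> rng k ->
    b p i j k = sgn R (psi_sign i j k) * t (i ^^ j ^^ k)%N.
  move=> p; case: (boolP (rng p)) => rp; last by exists (fun=> 0).
  have [u uP] := psi_contraction (b12 p) (b23 p) (fun i j k => @b_cross p i j k rp).
  by exists u.
pose bt p i j m := sgn R (psi_sign i j m) * t p (i ^^ j ^^ m)%N.
pose dbt p i j m n :=
  sgn R (sgn_mul (cross_sign m n) (psi_sign i j (m ^^ n)))
    * t p (i ^^ j ^^ (m ^^ n))%N
  + sgn R (sgn_mul (cross_sign i j) (psi_sign m n (i ^^ j)))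
    * t p (m ^^ n ^^ (i ^^ j))%N.
have dbtE p i j m n : rng p -> rng i -> rng j -> rng m -> rng n ->
    dbt p i j m n = db p i j m n.
  move=> rp ri rj rm rn; apply: esym; rewrite /db; congr (_ + _).
    have [->|rmn] := xor3_rng rm rn; first by rewrite /= !mul0r.
    by rewrite tP // sgnM mulrA.
  have [->|rij] := xor3_rng ri rj; first by rewrite /= !mul0r.
  by rewrite tP // sgnM mulrA.
have t_sym a d : rng a -> rng d -> (a < d)%N -> t a d = t d a.
  have E p i j m n : rng p -> rng i -> rng j -> rng m -> rng n ->
      dbt p i j m n - dbt i p j m n + dbt j p i m n - dbt m p i j n
      + dbt n p i j m = 0.
    by move=> *; rewrite !dbtE //; exact: dpsi.
  (* The complements of the three pairs {x, x ^^ a ^^ d} are the quintuples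
     of degree a ^^ d. *)
  case: a => [|[|[|[|[|[|[|[|a]]]]]]]] //;
  case: d => [|[|[|[|[|[|[|[|d]]]]]]]] //= _ _ _;
  match goal with |- _ ?a ?d = _ =>
    let E' x :=
      (let x := eval compute in x in
       let l := eval compute in
         [seq y <- iota 1 7 | (y != x) && (y != a ^^ d ^^ x)] in
       match l with [:: ?p; ?i; ?j; ?m; ?n] =>
         have := @E p i j m n isT isT isT isT isT end) in
    let x := eval compute in
      (head 0%N [seq y <- iota 1 7 | (y != a) && (y != d) && (y != a ^^ d)]) in
    E' a; E' x; E' (a ^^ x)
  end; rewrite /dbt /=; lra.
have E i j m n : rng i -> rng j -> rng m -> rng n ->
    bt i j m n - bt j i m n + bt m i j n - bt n i j m
    = k * sgn R (psi_sign4 i j m n).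
  by move=> *; rewrite /bt -!tP //; exact: dphi.
have t_off a d : rng a -> rng d -> (a < d)%N -> t a d = 0.
  (* The quadruples of degree z = a ^^ d are the unions of z with one of the
     four lines {y, x, y ^^ x} that avoid z. *)
  case: a => [|[|[|[|[|[|[|[|a]]]]]]]] //;
  case: d => [|[|[|[|[|[|[|[|d]]]]]]]] //= _ _ _;
  match goal with |- _ ?a ?d = _ =>
    let z := eval compute in (a ^^ d)%N in
    let E' y x :=
      (let x := eval compute in x in
       let yx := eval compute in (y ^^ x)%N in
       have := @E y x yx z isT isT isT isT) in
    let S x y :=
      let x := eval compute in x in let y := eval compute in y in
      first [have := @t_sym x y isT isT isT | have := @t_sym y x isT isT isT] in
    let x := eval compute in
      (head 0%N [seq y <- iota 1 7 | (y != a) && (y != d) && (y != a ^^ d)]) in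
    E' a x; E' d x; E' a (d ^^ x); E' d (a ^^ x);
    S a d; S x (a ^^ d ^^ x)%N; S (a ^^ x)%N (d ^^ x)%N
  end; rewrite /bt /=; lra.
(* The quadruples of degree 0 are the complements of the lines. *)
have t_diag a : rng a -> t a a = k / 4.
  have := @E 4 5 6 7 isT isT isT isT; have := @E 2 3 6 7 isT isT isT isT.
  have := @E 2 3 4 5 isT isT isT isT; have := @E 1 3 5 7 isT isT isT isT.
  have := @E 1 3 4 6 isT isT isT isT; have := @E 1 2 5 6 isT isT isT isT.
  have := @E 1 2 4 7 isT isT isT isT; rewrite /bt /=.
  by case: a => [|[|[|[|[|[|[|[|a]]]]]]]] //= *; lra.
move=> p i j m rp ri rj rm; rewrite tP // /psi_sign4.
case: eqP => [<-|/eqP ne]; first by rewrite t_diag // mulrC.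
have : (psi_sign i j m == None) || rng (i ^^ j ^^ m)%N.
  move: i j m {ne} ri rj rm; exact: (@all_rng3 (fun i j m =>
    (psi_sign i j m == None) || rng (i ^^ j ^^ m)%N)).
rewrite mulr0; case/predU1P => [->|rijm]; first by rewrite mul0r.
case: ltngtP ne => // lt_p _; first by rewrite t_off // mulr0.
by rewrite -t_sym // t_off // mulr0.
Qed.

End FrameAlgebra.

(** * Multilinear algebra of a form, a metric and their cross product *)

Section Multilinear.
Context {R : realType} {n : nat}.
Implicit Types (f : 'rV[R]_n -> R) (u v y z t : 'rV[R]_n) (G : 'M[R]_n).

Definition linear_form f := forall a u v, f (a *: u + v) = a * f u + f v.

Lemma linear_formD f u v : linear_form f -> f (u + v) = f u + f v.
Proof. by move=> fL; rewrite -[u]scale1r fL mul1r scale1r. Qed.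

Lemma linear_form0 f : linear_form f -> f 0 = 0.
Proof. by move=> fL; apply: (addrI (f 0)); rewrite addr0 -linear_formD ?addr0. Qed.

Lemma linear_formZ f a u : linear_form f -> f (a *: u) = a * f u.
Proof. by move=> fL; rewrite -[a *: u]addr0 fL linear_form0 // addr0. Qed.

Lemma linear_formN f u : linear_form f -> f (- u) = - f u.
Proof. by move=> fL; rewrite -scaleN1r linear_formZ // mulN1r. Qed.

Lemma linear_form_sum f (I : finType) (F : I -> 'rV[R]_n) :
  linear_form f -> f (\sum_i F i) = \sum_i f (F i).
Proof.
move=> fL; elim/big_rec2: _ => [|i u v _ <-]; first exact: linear_form0.
by rewrite linear_formD.
Qed.

Lemma linear_form_frame (A : 'M[R]_n) f :
  A \in unitmx -> linear_form f -> (forall i, f (row i A) = 0) -> forall u, f u = 0.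
Proof.
move=> Au fL fA u; rewrite -(mulmxKV Au u) mulmx_sum_row linear_form_sum //.
by apply: big1 => i _; rewrite linear_formZ // fA mulr0.
Qed.

Lemma linear_form3_frame (A : 'M[R]_n) (f : 'rV_n -> 'rV_n -> 'rV_n -> R) :
  A \in unitmx ->
  (forall v y, linear_form (fun u => f u v y)) ->
  (forall u y, linear_form (fun v => f u v y)) ->
  (forall u v, linear_form (fun y => f u v y)) ->
  (forall i j k, f (row i A) (row j A) (row k A) = 0) ->
  forall u v y, f u v y = 0.
Proof.
move=> Au L1 L2 L3 f0 u v y.
apply: (linear_form_frame Au (L3 u v)) => k.
apply: (linear_form_frame Au (L2 u _)) => j.
by apply: (linear_form_frame Au (L1 _ _)) => i.
Qed.

Lemma linear_form4_frame (A : 'M[R]_n) (f : 'rV_n -> 'rV_n -> 'rV_n -> 'rV_n -> R) :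
  A \in unitmx ->
  (forall v y z, linear_form (fun u => f u v y z)) ->
  (forall u y z, linear_form (fun v => f u v y z)) ->
  (forall u v z, linear_form (fun y => f u v y z)) ->
  (forall u v y, linear_form (fun z => f u v y z)) ->
  (forall i j k l, f (row i A) (row j A) (row k A) (row l A) = 0) ->
  forall u v y z, f u v y z = 0.
Proof.
move=> Au L1 L2 L3 L4 f0 u v y z.
apply: (linear_form_frame Au (L4 u v y)) => l.
apply: (linear_form_frame Au (L3 u v _)) => k.
apply: (linear_form_frame Au (L2 u _ _)) => j.
by apply: (linear_form_frame Au (L1 _ _ _)) => i.
Qed.

(** In this form the identity d phi = k psi, known in components, extends to
    arbitrary vectors. *)
Lemma alternation4_delta (N Q : 'rV_n -> 'rV_n -> 'rV_n -> 'rV_n -> R) (k : R) :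
  (forall v y z, linear_form (fun u => N u v y z)) ->
  (forall u y z, linear_form (fun v => N u v y z)) ->
  (forall u v z, linear_form (fun y => N u v y z)) ->
  (forall u v y, linear_form (fun z => N u v y z)) ->
  (forall v y z, linear_form (fun u => Q u v y z)) ->
  (forall u y z, linear_form (fun v => Q u v y z)) ->
  (forall u v z, linear_form (fun y => Q u v y z)) ->
  (forall u v y, linear_form (fun z => Q u v y z)) ->
  let F u v y z := N u v y z - N v u y z + N y u v z - N z u v y - k * Q u v y z in
  (forall i j l m,
     F (delta_mx 0 i) (delta_mx 0 j) (delta_mx 0 l) (delta_mx 0 m) = 0) ->
  forall u v y z, F u v y z = 0.
Proof.
move=> L1 L2 L3 L4 Q1 Q2 Q3 Q4 F F0.
apply: (@linear_form4_frame 1%:M); rewrite ?unitmx1 //.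
- by move=> * c t t'; rewrite /F L1 !L2 Q1; ring.
- by move=> * c t t'; rewrite /F L1 L2 !L3 Q2; ring.
- by move=> * c t t'; rewrite /F L1 !L3 L4 Q3; ring.
- by move=> * c t t'; rewrite /F L1 !L4 Q4; ring.
- by move=> *; rewrite !rowE !mulmx1.
Qed.

Lemma alternation5_delta (N : 'rV_n -> 'rV_n -> 'rV_n -> 'rV_n -> 'rV_n -> R) :
  (forall u v y z, linear_form (fun p => N p u v y z)) ->
  (forall p v y z, linear_form (fun u => N p u v y z)) ->
  (forall p u y z, linear_form (fun v => N p u v y z)) ->
  (forall p u v z, linear_form (fun y => N p u v y z)) ->
  (forall p u v y, linear_form (fun z => N p u v y z)) ->
  let F p u v y z :=
    N p u v y z - N u p v y z + N v p u y z - N y p u v z + N z p u v y in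
  (forall i j k l m, F (delta_mx 0 i) (delta_mx 0 j) (delta_mx 0 k)
     (delta_mx 0 l) (delta_mx 0 m) = 0) ->
  forall p u v y z, F p u v y z = 0.
Proof.
move=> L1 L2 L3 L4 L5 F F0 p u v y z.
apply: (@linear_form_frame 1%:M (F p u v y)) => [|c t t'|m].
- by rewrite unitmx1.
- by rewrite /F L1 !L5; ring.
rewrite rowE mulmx1.
apply: (@linear_form4_frame 1%:M (fun p u v y => F p u v y (delta_mx 0 m)));
  rewrite ?unitmx1 //.
- by move=> * c t t'; rewrite /F L1 !L2; ring.
- by move=> * c t t'; rewrite /F L1 L2 !L3; ring.
- by move=> * c t t'; rewrite /F L1 !L3 !L4; ring.
- by move=> * c t t'; rewrite /F L1 !L4 !L5; ring.
- by move=> *; rewrite !rowE !mulmx1.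
Qed.

Lemma dot_linl G v : linear_form (fun u => dot G u v).
Proof. by move=> a u u'; rewrite /dot !mulmxDl -!scalemxAl !mxE. Qed.

Lemma dot_linr G u : linear_form (dot G u).
Proof. by move=> a v v'; rewrite /dot linearP /= mulmxDr -scalemxAr !mxE. Qed.

Lemma dotZl G a u v : dot G (a *: u) v = a * dot G u v.
Proof. exact: (linear_formZ _ _ (dot_linl G v)). Qed.

Lemma dotZr G a u v : dot G u (a *: v) = a * dot G u v.
Proof. exact: (linear_formZ _ _ (dot_linr G u)). Qed.

Lemma dotNl G u v : dot G (- u) v = - dot G u v.
Proof. exact: (linear_formN _ (dot_linl G v)). Qed.

Lemma dotNr G u v : dot G u (- v) = - dot G u v.
Proof. exact: (linear_formN _ (dot_linr G u)). Qed.

Lemma dotC G u v : G^T = G -> dot G u v = dot G v u.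
Proof.
move=> GT; by rewrite /dot -{1}GT -{1}(trmxK u) -trmx_mul -trmx_mul mxE mulmxA.
Qed.

Lemma dotE G u v : dot G u v = \sum_i \sum_j G i j * u 0 i * v 0 j.
Proof.
rewrite /dot mxE exchange_big; apply: eq_bigr => j _ /=.
rewrite !mxE big_distrl /=; apply: eq_bigr => i _.
by rewrite (mulrC (u 0 i)).
Qed.

Lemma dot_nondeg G u v : G \in unitmx ->
  (forall z, dot G u z = dot G v z) -> u = v.
Proof.
move=> Gu E; apply: (can_inj (mulmxK Gu)); apply/rowP => j.
have := E (delta_mx 0 j); rewrite /dot trmx_delta -!colE.
by rewrite [LHS]mxE [RHS]mxE.
Qed.

Definition mk3 (i j k : 'I_n) : {ffun 'I_3 -> 'I_n} :=
  [ffun m => tnth [tuple i; j; k] m].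
Definition mk4 (i j k l : 'I_n) : {ffun 'I_4 -> 'I_n} :=
  [ffun m => tnth [tuple i; j; k; l] m].

Definition form3 (w : {ffun 'I_3 -> 'I_n} -> R) u v y : R :=
  form_eval w (tnth [tuple u; v; y]).
Definition form4 (w : {ffun 'I_4 -> 'I_n} -> R) u v y z : R :=
  form_eval w (tnth [tuple u; v; y; z]).

Lemma form3E w u v y : form3 w u v y =
  \sum_I w I * (u 0 (I 0) * v 0 (I 1) * y 0 (I (lift 0 1))).
Proof.
apply: eq_bigr => I _; congr (_ * _).
rewrite !big_ord_recl big_ord0 mulr1 !(tnth_nth 0) /= !mulrA.
by congr (_ * v 0 (I _) * y 0 (I _)); apply: val_inj.
Qed.

Lemma form4E w u v y z : form4 w u v y z =
  \sum_I w I * (u 0 (I 0) * v 0 (I 1) * y 0 (I (lift 0 1)) * z 0 (I (lift 0 (lift 0 1)))).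
Proof.
apply: eq_bigr => I _; congr (_ * _).
rewrite !big_ord_recl big_ord0 mulr1 !(tnth_nth 0) /= !mulrA.
by congr (_ * v 0 (I _) * y 0 (I _) * z 0 (I _)); apply: val_inj.
Qed.

Lemma form3_lin1 w v y : linear_form (fun u => form3 w u v y).
Proof.
move=> a u u'; rewrite !form3E mulr_sumr -big_split; apply: eq_bigr => I _ /=.
by rewrite !mxE; ring.
Qed.

Lemma form3_lin2 w u y : linear_form (fun v => form3 w u v y).
Proof.
move=> a v v'; rewrite !form3E mulr_sumr -big_split; apply: eq_bigr => I _ /=.
by rewrite !mxE; ring.
Qed.

Lemma form3_lin3 w u v : linear_form (fun y => form3 w u v y).
Proof.
move=> a y y'; rewrite !form3E mulr_sumr -big_split; apply: eq_bigr => I _ /=.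
by rewrite !mxE; ring.
Qed.

Lemma form4_lin1 w v y z : linear_form (fun u => form4 w u v y z).
Proof.
move=> a u u'; rewrite !form4E mulr_sumr -big_split; apply: eq_bigr => I _ /=.
by rewrite !mxE; ring.
Qed.

Lemma form4_lin2 w u y z : linear_form (fun v => form4 w u v y z).
Proof.
move=> a v v'; rewrite !form4E mulr_sumr -big_split; apply: eq_bigr => I _ /=.
by rewrite !mxE; ring.
Qed.

Lemma form4_lin3 w u v z : linear_form (fun y => form4 w u v y z).
Proof.
move=> a y y'; rewrite !form4E mulr_sumr -big_split; apply: eq_bigr => I _ /=.
by rewrite !mxE; ring.
Qed.

Lemma form4_lin4 w u v y : linear_form (fun z => form4 w u v y z).
Proof.
move=> a z z'; rewrite !form4E mulr_sumr -big_split; apply: eq_bigr => I _ /=.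
by rewrite !mxE; ring.
Qed.

Lemma form_eval_delta p (w : {ffun 'I_p -> 'I_n} -> R) (I : {ffun 'I_p -> 'I_n}) :
  form_eval w (fun k => delta_mx 0 (I k)) = w I.
Proof.
rewrite /form_eval (bigD1 I) //= big1 ?mulr1 => [|k _]; last by rewrite mxE !eqxx.
rewrite big1 ?addr0 // => J /eqP/ffunP neJ.
have [k neJk] : exists k, J k != I k.
  by apply/existsP; apply: contra_notT neJ => /existsPn H k; apply/eqP/negPn/H.
by rewrite (bigD1 k) //= mxE eqxx (negPf neJk) mul0r mulr0.
Qed.

Lemma form3_delta w i j k :
  form3 w (delta_mx 0 i) (delta_mx 0 j) (delta_mx 0 k) = w (mk3 i j k).
Proof.
rewrite -form_eval_delta /form3; congr form_eval; apply/funext => m.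
by rewrite ffunE; case: m => -[|[|[|m]]] // Hm; rewrite !(tnth_nth (delta_mx 0 i)) !(tnth_nth i).
Qed.

Lemma form4_delta w i j k l :
  form4 w (delta_mx 0 i) (delta_mx 0 j) (delta_mx 0 k) (delta_mx 0 l)
  = w (mk4 i j k l).
Proof.
rewrite -form_eval_delta /form4; congr form_eval; apply/funext => m.
by rewrite ffunE; case: m => -[|[|[|[|m]]]] // Hm; rewrite !(tnth_nth (delta_mx 0 i)) !(tnth_nth i).
Qed.

Lemma mk3_alt (w : {ffun 'I_3 -> 'I_n} -> R) i j k : alternating w ->
  w (mk3 j i k) = - w (mk3 i j k) /\ w (mk3 i k j) = - w (mk3 i j k).
Proof.
move=> walt; split.
  rewrite -mulN1r; have := walt (mk3 i j k) (tperm 0 1).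
  rewrite odd_tperm expr1 => <-; congr w; apply/ffunP => m; rewrite !ffunE.
  by case: tpermP => [->|->|/eqP n0 /eqP n1]; rewrite ?(tnth_nth i) //;
    case: m n0 n1 => -[|[|[|m]]].
rewrite -mulN1r; have := walt (mk3 i j k) (tperm 1 (lift 0 1)).
rewrite odd_tperm expr1 => <-; congr w; apply/ffunP => m; rewrite !ffunE.
by case: tpermP => [->|->|/eqP n0 /eqP n1]; rewrite ?(tnth_nth i) //;
    case: m n0 n1 => -[|[|[|m]]].
Qed.

Lemma form3C12 w u v y : alternating w -> form3 w v u y = - form3 w u v y.
Proof.
move=> walt; apply/eqP; rewrite -addr_eq0; apply/eqP.
apply: (@linear_form3_frame 1%:M (fun u v y => form3 w v u y + form3 w u v y));
  rewrite ?unitmx1 // => *.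
- by move=> a ? ?; rewrite form3_lin2 form3_lin1; ring.
- by move=> a ? ?; rewrite form3_lin2 form3_lin1; ring.
- by move=> a ? ?; rewrite !form3_lin3; ring.
- by rewrite !rowE !mulmx1 !form3_delta (mk3_alt _ _ _ walt).1 addNr.
Qed.

Lemma form3C23 w u v y : alternating w -> form3 w u y v = - form3 w u v y.
Proof.
move=> walt; apply/eqP; rewrite -addr_eq0; apply/eqP.
apply: (@linear_form3_frame 1%:M (fun u v y => form3 w u y v + form3 w u v y));
  rewrite ?unitmx1 // => *.
- by move=> a ? ?; rewrite !form3_lin1; ring.
- by move=> a ? ?; rewrite form3_lin2 form3_lin3; ring.
- by move=> a ? ?; rewrite form3_lin2 form3_lin3; ring.
- by rewrite !rowE !mulmx1 !form3_delta (mk3_alt _ _ _ walt).2 addNr.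
Qed.

End Multilinear.

(** * Determinants of selections of basis vectors *)

Section SelectionDeterminant.
Variable R : realType.

(** A permutation sign that can be evaluated. The determinant is 0, 1 or -1, and
    multiplying the selection matrix by the Vandermonde matrix on the nodes
    0, ..., n-1, of positive determinant, gives a Vandermonde matrix again. *)
Lemma det_basis_rows n (K : {ffun 'I_n -> 'I_n}) :
  \det (basis_rows K : 'M[R]_n) =
  \prod_(i < n) \prod_(j < n | (i < j)%N) Num.sg ((K j)%:R - (K i)%:R).
Proof.
pose V := Vandermonde n (\row_(i < n) i%:R : 'rV[R]_n).
have V_gt0 : 0 < \det V.
  rewrite det_Vandermonde; apply: prodr_gt0 => i _; apply: prodr_gt0 => j ij.
  by rewrite !mxE subr_gt0 ltr_nat.
have -> : \det (basis_rows K : 'M[R]_n) = Num.sg (\det (basis_rows K : 'M[R]_n)).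
  have [/injectiveP Kinj|/injectivePn[i [j ij Kij]]] := boolP (injectiveb K).
    suff -> : basis_rows K = perm_mx (perm Kinj) :> 'M[R]_n.
      by rewrite det_perm; case: odd_perm; rewrite ?expr0 ?expr1 ?sgrN sgr1.
    by apply/matrixP => i j; rewrite !mxE permE.
  by rewrite (determinant_alternate ij) ?sgr0 // => k; rewrite !mxE Kij.
have -> : Num.sg (\det (basis_rows K : 'M[R]_n))
    = Num.sg (\det (basis_rows K *m V^T)).
  by rewrite det_mulmx det_tr sgrM (gtr0_sg V_gt0) mulr1.
have -> : (basis_rows K : 'M[R]_n) *m V^T
    = (Vandermonde n (\row_(i < n) (K i)%:R : 'rV[R]_n))^T.
  apply/matrixP => i j; rewrite !mxE (bigD1 (K i)) //= !mxE eqxx mul1r.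
  by rewrite big1 ?addr0 // => k /negPf nk; rewrite !mxE eq_sym nk mul0r.
have sgr_prod := big_morph Num.sg (@sgrM R) (sgr1 R).
rewrite det_tr det_Vandermonde sgr_prod; apply: eq_bigr => i _.
by rewrite sgr_prod; apply: eq_bigr => j _; rewrite !mxE.
Qed.

Lemma prod_basis_rows p n (C : 'M[R]_(p, n)) (s : 'I_p -> 'I_n) :
  \prod_k C k (s k) =
  \sum_(J : {ffun 'I_p -> 'I_n}) (\prod_k C k (J k)) * \prod_k basis_rows J k (s k).
Proof.
under [RHS]eq_bigr => J _ do rewrite -big_split /=.
transitivity (\prod_k \sum_j C k j * (j == s k)%:R).
  apply: eq_bigr => k _; rewrite (bigD1 (s k)) //= eqxx mulr1.
  by rewrite big1 ?addr0 // => j /negPf ->; rewrite mulr0.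
by rewrite bigA_distr_bigA; do 2!apply: eq_bigr => ? _; rewrite mxE.
Qed.

Lemma det_expand_down p q (B : 'M[R]_(p, p + q)) (C : 'M[R]_(q, p + q)) :
  \det (col_mx B C) = \sum_(J : {ffun 'I_q -> 'I_(p + q)})
    (\prod_k C k (J k)) * \det (col_mx B (basis_rows J)).
Proof.
under [RHS]eq_bigr => J _ do rewrite big_distrr /=.
rewrite exchange_big /=; apply: eq_bigr => s _.
rewrite big_split_ord /=.
under [X in _ * (_ * X)]eq_bigr => k _ do rewrite col_mxEd.
rewrite (prod_basis_rows C (fun k => s (rshift p k))) !big_distrr.
apply: eq_bigr => J _; rewrite big_split_ord /= [RHS]mulrCA; congr (_ * _).
rewrite [LHS]mulrCA; congr (_ * (_ * _)); apply: eq_bigr => k _.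
  by rewrite !col_mxEu.
by rewrite col_mxEd.
Qed.

Lemma det_expand_up p q (B : 'M[R]_(p, p + q)) (C : 'M[R]_(q, p + q)) :
  \det (col_mx B C) = \sum_(I : {ffun 'I_p -> 'I_(p + q)})
    (\prod_k B k (I k)) * \det (col_mx (basis_rows I) C).
Proof.
under [RHS]eq_bigr => I _ do rewrite big_distrr /=.
rewrite exchange_big /=; apply: eq_bigr => s _.
rewrite big_split_ord /=.
under [X in _ * (X * _)]eq_bigr => k _ do rewrite col_mxEu.
rewrite (prod_basis_rows B (fun k => s (lshift q k))) big_distrl big_distrr.
apply: eq_bigr => I _; rewrite big_split_ord /= [RHS]mulrCA; congr (_ * _).
rewrite -mulrA; congr (_ * (_ * _)); apply: eq_bigr => k _.
  by rewrite col_mxEu.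
by rewrite !col_mxEd.
Qed.

End SelectionDeterminant.

Section SelectionDeterminantSums.
Variable R : realType.

Lemma det_row_perm_up p q (B : 'M[R]_(p, p + q)) (C : 'M[R]_(q, p + q)) (s : 'S_p) :
  \det (col_mx (row_perm s B) C) = (-1) ^+ s * \det (col_mx B C).
Proof.
have -> : col_mx (row_perm s B) C = block_mx (perm_mx s) 0 0 1%:M *m col_mx B C.
  by rewrite mul_block_col !mul0mx addr0 add0r mul1mx row_permE.
by rewrite det_mulmx det_ublock det1 mulr1 det_perm.
Qed.

(** Each of the p! orderings of I contributes the same term. *)
Lemma sum_basis_form_det p q (I : {ffun 'I_p -> 'I_(p + q)}) (C : 'M[R]_(q, p + q)) :
  \sum_(L : {ffun 'I_p -> 'I_(p + q)}) basis_form I L * \det (col_mx (basis_rows L) C)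
  = p`!%:R * \det (col_mx (basis_rows I) C).
Proof.
transitivity (\sum_(s : 'S_p) (-1) ^+ s * \det (col_mx (row_perm s (basis_rows I)) C)).
  under [RHS]eq_bigr => s _ do rewrite det_expand_up big_distrr /=.
  rewrite exchange_big; apply: eq_bigr => L _ /=.
  under [RHS]eq_bigr => s _ do rewrite mulrA.
  rewrite -big_distrl; congr (_ * _); rewrite /basis_form -det_tr.
  apply: eq_bigr => s _; congr (_ * _); apply: eq_bigr => k _.
  rewrite !mxE (bigD1 (L k)) //= !mxE eqxx mulr1 big1 ?addr0 // => j /negPf nj.
  by rewrite !mxE [L k == j]eq_sym nj mulr0.
under eq_bigr => s _ do rewrite det_row_perm_up mulrA -expr2 sqrr_sign mul1r.
by rewrite sumr_const cardT -cardE card_Sn mulr_natl.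
Qed.

Definition compare_sign (i j : nat) : sign3 :=
  if (i < j)%N then Some true else if (j < i)%N then Some false else None.

(** The sign of the permutation that sorts s, or None if s has a repetition. *)
Fixpoint list_sign (s : seq nat) : sign3 :=
  if s is i :: s' then
    sgn_mul (foldr (fun j => sgn_mul (compare_sign i j)) (Some true) s') (list_sign s')
  else Some true.

Lemma sgn_compare i j : sgn R (compare_sign i j) = Num.sg (j%:R - i%:R).
Proof.
rewrite /compare_sign; case: ltngtP => [lt_ij|lt_ji|->] /=.
- by rewrite gtr0_sg // subr_gt0 ltr_nat.
- by rewrite ltr0_sg // subr_lt0 ltr_nat.
- by rewrite subrr sgr0.
Qed.

Lemma sgn_list s : sgn R (list_sign s) =
  \prod_(i < size s) \prod_(j < size s | (i < j)%N)
    Num.sg ((nth 0%N s j)%:R - (nth 0%N s i)%:R).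
Proof.
elim: s => [|x s IHs] /=; first by rewrite big_ord0.
rewrite sgnM IHs big_ord_recl [X in _ = X * _]big_mkcond big_ord_recl /= mul1r.
congr (_ * _).
  elim: s {IHs} => [|y s IHs] /=; first by rewrite big_ord0.
  by rewrite sgnM IHs big_ord_recl sgn_compare.
by apply: eq_bigr => i _; rewrite [RHS]big_mkcond big_ord_recl /= mul1r -big_mkcond.
Qed.

Lemma det2 (M : 'M[R]_2) : \det M = M 0 0 * M 1 1 - M 0 1 * M 1 0.
Proof.
rewrite (expand_det_row _ 0) !big_ord_recl big_ord0 /cofactor !det_mx11 !mxE /=.
have -> : lift 0 0 = 1 :> 'I_2 by apply: val_inj.
have -> : lift 1 0 = 0 :> 'I_2 by apply: val_inj.
by rewrite /bump /=; ring.
Qed.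

Lemma det3 (M : 'M[R]_3) : \det M =
  M 0 0 * (M 1 1 * M (lift 0 1) (lift 0 1) - M 1 (lift 0 1) * M (lift 0 1) 1)
  - M 0 1 * (M 1 0 * M (lift 0 1) (lift 0 1) - M 1 (lift 0 1) * M (lift 0 1) 0)
  + M 0 (lift 0 1) * (M 1 0 * M (lift 0 1) 1 - M 1 1 * M (lift 0 1) 0).
Proof.
rewrite (expand_det_row _ 0) !big_ord_recl big_ord0 /cofactor !det2 !mxE /=.
have E0 : lift 0 (0 : 'I_2) = 1 :> 'I_3 by apply: val_inj.
have E1 : lift 0 (lift 0 (0 : 'I_1)) = lift 0 1 :> 'I_3 by apply: val_inj.
have E2 : lift 1 (0 : 'I_2) = 0 :> 'I_3 by apply: val_inj.
have E3 : lift 1 (1 : 'I_2) = lift 0 1 :> 'I_3 by apply: val_inj.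
have E4 : lift (lift 0 1) (0 : 'I_2) = 0 :> 'I_3 by apply: val_inj.
have E5 : lift (lift 0 1) (1 : 'I_2) = 1 :> 'I_3 by apply: val_inj.
by rewrite E1 E0 E2 E3 E4 E5 /bump /=; ring.
Qed.

End SelectionDeterminantSums.

(** * The cross product and the dual 4-form at a point *)

Section CrossAlgebra.
Context {R : realType}.
Implicit Types (G A : 'M[R]_7) (w : {ffun 'I_3 -> 'I_7} -> R) (u v y z : 'rV[R]_7).

Lemma cross_dot G w u v z : G \in unitmx -> dot G (cross G w u v) z = form3 w u v z.
Proof. by move=> Gu; rewrite -crossP. Qed.

Lemma cross_linl G w a u u' v :
  cross G w (a *: u + u') v = a *: cross G w u v + cross G w u' v.
Proof.
rewrite /cross scalemxAl -mulmxDl; congr (_ *m _).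
by apply/rowP => c; rewrite !mxE -/(form3 _ _ _ _) form3_lin1.
Qed.

Lemma cross_linr G w a u v v' :
  cross G w u (a *: v + v') = a *: cross G w u v + cross G w u v'.
Proof.
rewrite /cross scalemxAl -mulmxDl; congr (_ *m _).
by apply/rowP => c; rewrite !mxE -/(form3 _ _ _ _) form3_lin2.
Qed.

Lemma cross0l G w v : cross G w 0 v = 0.
Proof.
have := cross_linl G w 1 0 0 v; rewrite scaler0 addr0 scale1r => E.
by apply: (addrI (cross G w 0 v)); rewrite addr0 -E.
Qed.

Lemma cross0r G w u : cross G w u 0 = 0.
Proof.
have := cross_linr G w 1 u 0 0; rewrite scaler0 addr0 scale1r => E.
by apply: (addrI (cross G w u 0)); rewrite addr0 -E.
Qed.

Lemma crossC G w u v : alternating w -> cross G w v u = - cross G w u v.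
Proof.
move=> walt; rewrite /cross -mulNmx; congr (_ *m _).
by apply/rowP => c; rewrite !mxE -/(form3 _ _ _ _) form3C12.
Qed.

(** For a G2 structure this combination of the metric and the cross product is
    alternating, and is equal to the Hodge star of the 3-form. Unlike the latter
    it is polynomial in the metric and the cross product, hence can be
    differentiated by the Leibniz rule. *)
Definition psi4 G w u v y z : R :=
  dot G (cross G w u v) (cross G w y z) - dot G u y * dot G v z
  + dot G u z * dot G v y.

Lemma psi4_lin1 G w v y z : linear_form (fun u => psi4 G w u v y z).
Proof. by move=> a u u'; rewrite /psi4 cross_linl !dot_linl; ring. Qed.

Lemma psi4_lin2 G w u y z : linear_form (fun v => psi4 G w u v y z).
Proof. by move=> a v v'; rewrite /psi4 cross_linr !dot_linl; ring. Qed.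

Lemma psi4_lin3 G w u v z : linear_form (fun y => psi4 G w u v y z).
Proof. by move=> a y y'; rewrite /psi4 cross_linl !dot_linr; ring. Qed.

Lemma psi4_lin4 G w u v y : linear_form (fun z => psi4 G w u v y z).
Proof. by move=> a z z'; rewrite /psi4 cross_linr !dot_linr; ring. Qed.

Lemma psi4C12 G w u v y z : alternating w -> psi4 G w v u y z = - psi4 G w u v y z.
Proof.
by move=> walt; rewrite /psi4 (crossC _ u v) // dotNl; ring.
Qed.

Lemma psi4C34 G w u v y z : alternating w -> psi4 G w u v z y = - psi4 G w u v y z.
Proof.
by move=> walt; rewrite /psi4 (crossC _ y z) // dotNr; ring.
Qed.

End CrossAlgebra.

Lemma all_rng4 (P : nat -> nat -> nat -> nat -> bool) :
  all (fun i => all (fun j => all (fun k => all (P i j k) (iota 1 7))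
    (iota 1 7)) (iota 1 7)) (iota 1 7) ->
  forall i j k l, rng i -> rng j -> rng k -> rng l -> P i j k l.
Proof.
move=> /allP Pr i j k l; rewrite !rng_iota.
by move=> /Pr/allP Pi /Pi/allP Pj /Pj/allP Pk /Pk.
Qed.

Lemma sgn_int (R : pzRingType) s : sgn R s = (sgn int s)%:~R.
Proof. by case: s => [[]|]. Qed.

Section ModelForm.
Variable R : realType.

(** Indices on R^7 are labelled from 1 to 7, ordinals from 0 to 6. *)
Definition ord7 (i : nat) : 'I_7 := inord i.-1.

Lemma ord7_eq i j : rng i -> rng j -> (ord7 i == ord7 j) = (i == j).
Proof.
case/andP=> i0 i7 /andP[j0 j7]; rewrite -val_eqE /= !inordK ?prednK //.
by case: i j i0 j0 {i7 j7} => [|i] [|j].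
Qed.

(** The determinant of the 3 x 3 matrix with entries [a_r = i_s]. *)
Definition e3_int (a b c i j k : nat) : int :=
  let d x y : int := (x == y)%:R in
  d a i * (d b j * d c k - d b k * d c j) - d a j * (d b i * d c k - d b k * d c i)
  + d a k * (d b i * d c j - d b j * d c i).

Lemma e3E a b c i j k : rng a -> rng b -> rng c -> rng i -> rng j -> rng k ->
  @e3 R a b c (mk3 (ord7 i) (ord7 j) (ord7 k)) = (e3_int a b c i j k)%:~R.
Proof.
move=> *; rewrite /e3 /basis_form det3.
pose I : {ffun 'I_3 -> 'I_7} := [ffun m => inord (tnth [tuple a; b; c] m).-1].
rewrite -/I; set J := mk3 _ _ _.
have E r s : (basis_rows I *m (basis_rows J)^T : 'M[R]_3) r s = (I r == J s)%:R.
  rewrite mxE (bigD1 (I r)) //= !mxE eqxx mul1r big1 ?addr0 1?eq_sym // => l nl.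
  by rewrite !mxE eq_sym (negPf nl) mul0r.
rewrite !E !ffunE !(tnth_nth 0%N) !(tnth_nth 0) /= -!/(ord7 _) !ord7_eq //.
by rewrite /e3_int /= !(rmorphD, rmorphN, rmorphM) /= !rmorph_nat.
Qed.

Definition g2_model_int (i j k : nat) : int :=
  e3_int 1 2 3 i j k + e3_int 1 4 5 i j k + e3_int 1 6 7 i j k
  + e3_int 2 4 6 i j k - e3_int 2 5 7 i j k - e3_int 3 4 7 i j k
  - e3_int 3 5 6 i j k.

(** The signed cross product table is the model 3-form with one index raised. *)
Lemma g2_modelE i j k : rng i -> rng j -> rng k ->
  @g2_model R (mk3 (ord7 i) (ord7 j) (ord7 k))
  = sgn R (cross_sign i j) * (i ^^ j == k)%:R.
Proof.
move=> ri rj rk.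
have : g2_model_int i j k == sgn int (cross_sign i j) * (i ^^ j == k)%:R.
  move: i j k ri rj rk; apply: (@all_rng3 (fun i j k =>
    g2_model_int i j k == sgn int (cross_sign i j) * (i ^^ j == k)%:R)).
  by vm_compute.
move/eqP/(congr1 (fun x : int => x%:~R : R)).
rewrite rmorphM /= -sgn_int rmorph_nat => <-.
by rewrite /g2_model !e3E // /g2_model_int !(rmorphD, rmorphN).
Qed.

Lemma det_selection_sign a b c i j k l :
  rng a -> rng b -> rng c -> rng i -> rng j -> rng k -> rng l ->
  \det (@col_mx R 3 4 7 (basis_rows (mk3 (ord7 a) (ord7 b) (ord7 c)))
         (basis_rows (mk4 (ord7 i) (ord7 j) (ord7 k) (ord7 l))))
  = sgn R (list_sign [:: a; b; c; i; j; k; l]).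
Proof.
move=> ra rb rc ri rj rk rl.
pose s := [:: a; b; c; i; j; k; l].
pose K : {ffun 'I_7 -> 'I_7} := [ffun m : 'I_7 => ord7 (nth 0%N s m)].
have s_rng (m : 'I_7) : rng (nth 0%N s m).
  by case: m => -[|[|[|[|[|[|[|m]]]]]]] /= Hm; rewrite /= ?ra ?rb ?rc ?ri ?rj ?rk ?rl.
transitivity (\det (basis_rows K : 'M[R]_7)).
  congr (\det _); apply/matrixP => r m; rewrite mxE [RHS]mxE ffunE.
  by case: split_ordP => x ->; rewrite !mxE !ffunE; case: x => -[|[|[|[|x]]]] // Hx;
    rewrite (tnth_nth 0).
rewrite det_basis_rows sgn_list /=.
apply: eq_bigr => m _; apply: eq_bigr => m' _; congr (Num.sg _).
rewrite !ffunE /ord7 !inordK; last 2 first.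
- by case/andP: (s_rng m); case: (nth _ _ _).
- by case/andP: (s_rng m'); case: (nth _ _ _).
have pred1 n : rng n -> n.-1%:R = n%:R - 1 :> R.
  by case: n => [|n] //= _; rewrite -[in RHS]addn1 natrD addrK.
by rewrite !pred1 //; ring.
Qed.

(** The Hodge star of the model 3-form, on basis vectors. By sum_basis_form_det
    it is a sum over the seven lines only, and can be evaluated. *)
Lemma hodge_modelE i j k l : rng i -> rng j -> rng k -> rng l ->
  \sum_(L : {ffun 'I_3 -> 'I_7}) g2_model L *
     \det (@col_mx R 3 4 7 (basis_rows L)
            (basis_rows (mk4 (ord7 i) (ord7 j) (ord7 k) (ord7 l))))
  = 3`!%:R * sgn R (psi_sign4 i j k l).
Proof.
move=> ri rj rk rl; set C := basis_rows _.
have e3_sum a b c : rng a -> rng b -> rng c ->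
    \sum_L @e3 R a b c L * \det (@col_mx R 3 4 7 (basis_rows L) C)
    = 3`!%:R * sgn R (list_sign [:: a; b; c; i; j; k; l]).
  move=> ra rb rc; rewrite -det_selection_sign // -(@sum_basis_form_det R 3 4).
  apply: eq_bigr => L _; congr (basis_form _ L * _).
  apply/ffunP => m; rewrite !ffunE; case: m => -[|[|[|m]]] // Hm;
    by rewrite !(tnth_nth 0%N) !(tnth_nth 0).
under eq_bigr => L _ do rewrite /g2_model !(mulrDl, mulNr).
rewrite !big_split /= !sumrN !e3_sum // -!mulrN -!mulrDr; congr (_ * _).
pose S a b c i j k l := sgn int (list_sign [:: a; b; c; i; j; k; l]).
pose T i j k l : int := S 1 2 3 i j k l + S 1 4 5 i j k l + S 1 6 7 i j k l
  + S 2 4 6 i j k l - S 2 5 7 i j k l - S 3 4 7 i j k l - S 3 5 6 i j k l.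
have : T i j k l == sgn int (psi_sign4 i j k l).
  move: (i) (j) (k) (l) ri rj rk rl; apply: (@all_rng4 (fun i j k l =>
    T i j k l == sgn int (psi_sign4 i j k l))).
  by vm_compute.
move/eqP/(congr1 (fun x : int => x%:~R : R)); rewrite -sgn_int => <-.
by rewrite /T /S !(rmorphD, rmorphN) /= -!sgn_int.
Qed.

End ModelForm.

Section AdaptedFrame.
Variables (R : realType) (G A : 'M[R]_7) (w : {ffun 'I_3 -> 'I_7} -> R).
Hypotheses (Gsym : G^T = G) (Gunit : G \in unitmx) (walt : alternating w).
Hypotheses (Aw : adapted_frame w A) (AG : A *m G *m A^T = 1%:M).

Let Aunit : A \in unitmx. Proof. by case: Aw. Qed.

Let e i := row (ord7 i) A.

Let row_frame (k : 'I_7) : row k A = e k.+1.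
Proof. by rewrite /e /ord7 /= inord_val. Qed.

Let rngS (k : 'I_7) : rng k.+1. Proof. by rewrite /= ltnS ltn_ord. Qed.

Lemma frame_dot i j : rng i -> rng j -> dot G (e i) (e j) = (i == j)%:R.
Proof.
move=> ri rj; have := congr1 (fun M : 'M_7 => M (ord7 i) (ord7 j)) AG.
rewrite [RHS]mxE ord7_eq // => <-; rewrite /dot /e -row_mul !mxE.
by apply: eq_bigr => k _; rewrite !mxE.
Qed.

Lemma frame_form3 i j k : rng i -> rng j -> rng k ->
  form3 w (e i) (e j) (e k) = sgn R (cross_sign i j) * (i ^^ j == k)%:R.
Proof.
move=> ri rj rk; rewrite -g2_modelE // -(Aw.2 _); congr form_eval; apply/funext => m.
by rewrite ffunE; case: m => -[|[|[|m]]] // Hm; rewrite !(tnth_nth 0) /=.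
Qed.

Lemma frame_cross i j : rng i -> rng j ->
  cross G w (e i) (e j) = sgn R (cross_sign i j) *: e (i ^^ j).
Proof.
move=> ri rj; apply: (dot_nondeg Gunit) => z; apply/eqP; rewrite -subr_eq0; apply/eqP.
apply: (@linear_form_frame _ _ A
  (fun z => dot G (cross G w (e i) (e j)) z
    - dot G (sgn R (cross_sign i j) *: e (i ^^ j)) z)) => //.
  by move=> a y y'; rewrite !dot_linr; ring.
move=> k; rewrite row_frame cross_dot // frame_form3 ?rngS // dotZl.
have [->|rij] := xor3_rng ri rj; first by rewrite !mul0r subrr.
by rewrite frame_dot ?rngS // subrr.
Qed.

Lemma frame_psi4 i j k l : rng i -> rng j -> rng k -> rng l ->
  psi4 G w (e i) (e j) (e k) (e l) = sgn R (psi_sign4 i j k l).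
Proof.
move=> ri rj rk rl; rewrite /psi4 !frame_cross // dotZl dotZr.
have -> : sgn R (cross_sign i j) *
    (sgn R (cross_sign k l) * dot G (e (i ^^ j)) (e (k ^^ l)))
  = (sgn int (cross_sign i j) * (sgn int (cross_sign k l) * (i ^^ j == k ^^ l)%:R))%:~R.
  rewrite !rmorphM /= -!sgn_int rmorph_nat.
  have [->|rij] := xor3_rng ri rj; first by rewrite !mul0r.
  have [->|rkl] := xor3_rng rk rl; first by rewrite !mul0r.
  by rewrite frame_dot.
rewrite !frame_dot //.
pose T i j k l : int :=
  sgn int (cross_sign i j) * (sgn int (cross_sign k l) * (i ^^ j == k ^^ l)%:R)
  - (i == k)%:R * (j == l)%:R + (i == l)%:R * (j == k)%:R.
have : T i j k l == sgn int (psi_sign4 i j k l).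
  move: (i) (j) (k) (l) ri rj rk rl; apply: (@all_rng4 (fun i j k l =>
    T i j k l == sgn int (psi_sign4 i j k l))).
  by vm_compute.
move/eqP/(congr1 (fun x : int => x%:~R : R)); rewrite -sgn_int => <-.
by rewrite /T !(rmorphD, rmorphN, rmorphM) /= !rmorph_nat.
Qed.

Lemma psi4C13 u v y z : psi4 G w y v u z = - psi4 G w u v y z.
Proof.
apply/eqP; rewrite -addr_eq0; apply/eqP.
apply: (@linear_form4_frame _ _ A
  (fun u v y z => psi4 G w y v u z + psi4 G w u v y z)) => //.
- by move=> * a ? ?; rewrite psi4_lin1 psi4_lin3; ring.
- by move=> * a ? ?; rewrite !psi4_lin2; ring.
- by move=> * a ? ?; rewrite psi4_lin1 psi4_lin3; ring.
- by move=> * a ? ?; rewrite !psi4_lin4; ring.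
move=> i0 j0 k0 l0; rewrite !row_frame !frame_psi4 ?rngS //.
have /eqP -> : psi_sign4 k0.+1 j0.+1 i0.+1 l0.+1
    == omap negb (psi_sign4 i0.+1 j0.+1 k0.+1 l0.+1).
  have : rng i0.+1 && rng j0.+1 && rng k0.+1 && rng l0.+1 by rewrite !rngS.
  case/andP => /andP[/andP[]]; move: (i0.+1) (j0.+1) (k0.+1) (l0.+1).
  apply: (@all_rng4 (fun i j k l =>
    psi_sign4 k j i l == omap negb (psi_sign4 i j k l))).
  by vm_compute.
by rewrite sgnN addNr.
Qed.

(** The polarisation of |u x v|^2 = |u|^2 |v|^2 - <u, v>^2. *)
Lemma cross_cross_dot u v z :
  dot G (cross G w u v) (cross G w u z) = dot G u u * dot G v z - dot G u z * dot G v u.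
Proof.
have := psi4C13 u v u z; rewrite /psi4 => E.
have {}E : psi4 G w u v u z = 0 by rewrite /psi4; lra.
by rewrite /psi4 in E; lra.
Qed.

Lemma cross_crossr u v : cross G w u (cross G w u v) = dot G u v *: u - dot G u u *: v.
Proof.
apply: (dot_nondeg Gunit) => z.
rewrite cross_dot // form3C23 // -(cross_dot _ _ _ _ Gunit) cross_cross_dot.
rewrite dot_linl dotNl dotZl.
by rewrite (dotC z v Gsym) (dotC z u Gsym); ring.
Qed.

(** Both sides are multilinear, hence can be compared on the frame, where the
    star becomes that of the model form: the volume s * sqrt (det G) * det A of
    an oriented orthonormal frame is 1, and raising indices turns the dual frame
    into the frame. *)
Lemma hodge_psi4 (s : R) i j k l :
  s = 1 \/ s = -1 -> 0 < s * \det A ->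
  @hodge R 3 4 s G w (mk4 i j k l)
  = psi4 G w (delta_mx 0 i) (delta_mx 0 j) (delta_mx 0 k) (delta_mx 0 l).
Proof.
move=> s_unit sA.
have vol : s * Num.sqrt (\det G) * \det A = 1.
  have detG : \det A ^+ 2 * \det G = 1.
    have := congr1 (fun M => \det M) AG.
    by rewrite !det_mulmx det_tr det1 => <-; ring.
  have -> : s * Num.sqrt (\det G) * \det A = (s * \det A) * Num.sqrt (\det G) by ring.
  have G_ge0 : 0 <= \det G.
    have : 0 < \det A ^+ 2 * \det G by rewrite detG.
    rewrite pmulr_rgt0 => [/ltW //|].
    by rewrite exprn_even_gt0 //= -unitfE -unitmxE.
  have v_ge0 : 0 <= s * \det A * Num.sqrt (\det G).
    by rewrite mulr_ge0 ?sqrtr_ge0 // ltW.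
  apply/eqP; rewrite -(@eqrXn2 _ 2) // expr1n !exprMn sqr_sqrtr // -mulrA detG mulr1.
  by case: s_unit => ->; rewrite ?sqrrN expr1n.
apply/eqP; rewrite -subr_eq0 -form4_delta; apply/eqP.
apply: (@linear_form4_frame _ _ A (fun u v y z => form4 (@hodge R 3 4 s G w) u v y z
  - psi4 G w u v y z)) => //.
- by move=> * a ? ?; rewrite form4_lin1 psi4_lin1; ring.
- by move=> * a ? ?; rewrite form4_lin2 psi4_lin2; ring.
- by move=> * a ? ?; rewrite form4_lin3 psi4_lin3; ring.
- by move=> * a ? ?; rewrite form4_lin4 psi4_lin4; ring.
move=> i0 j0 k0 l0; rewrite !row_frame !frame_psi4 ?rngS //.
set i' := i0.+1; set j' := j0.+1; set k' := k0.+1; set l' := l0.+1.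
pose K := mk4 (ord7 i') (ord7 j') (ord7 k') (ord7 l').
apply/eqP; rewrite subr_eq0; apply/eqP.
have -> : form4 (@hodge R 3 4 s G w) (e i') (e j') (e k') (e l')
    = form_eval (@hodge R 3 4 s G w) (fun m => row (K m) A).
  congr form_eval; apply/funext => m; rewrite ffunE.
  by case: m => -[|[|[|[|m]]]] // Hm; rewrite !(tnth_nth 0).
pose wup I := form_eval w (fun m => row (I m) (invmx G)).
have -> : form_eval (@hodge R 3 4 s G w) (fun m => row (K m) A) =
    s * Num.sqrt (\det G) / 3`!%:R *
    \sum_(I : {ffun 'I_3 -> 'I_7}) wup I *
      \det (@col_mx R 3 4 7 (basis_rows I) (basis_rows K *m A)).
  rewrite /form_eval /hodge.
  under eq_bigr => J _ do rewrite -mulrA.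
  rewrite -big_distrr /=; congr (_ * _).
  under eq_bigr => J _ do rewrite big_distrl.
  rewrite exchange_big; apply: eq_bigr => I _ /=.
  rewrite (@det_expand_down R 3 4) big_distrr; apply: eq_bigr => J _ /=.
  rewrite -mulrA; congr (_ * _); rewrite mulrC; congr (_ * _).
  apply: eq_bigr => m _; rewrite !mxE (bigD1 (K m)) //= !mxE eqxx mul1r.
  rewrite big1 ?addr0 // => x nx.
  by rewrite !mxE eq_sym (negPf nx) mul0r.
have frame_up (L : {ffun 'I_3 -> 'I_7}) :
    \sum_(I : {ffun 'I_3 -> 'I_7}) wup I * \prod_m invmx A (I m) (L m) = g2_model L.
  rewrite -(Aw.2 L).
  have AE : (invmx A)^T *m invmx G = A.
    apply: (can_inj (mulmxK Gunit)); rewrite mulmxKV //.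
    have ATunit : A^T \in unitmx by rewrite unitmx_tr.
    by apply: (can_inj (mulmxK ATunit)); rewrite AG trmx_inv mulVmx.
  under eq_bigr => I _ do rewrite /wup /form_eval big_distrl /=.
  rewrite exchange_big; apply: eq_bigr => J _ /=.
  under eq_bigr => I _ do rewrite -mulrA -big_split /=.
  rewrite -big_distrr /=; congr (_ * _).
  rewrite -(bigA_distr_bigA (fun m x => row x (invmx G) 0 (J m) * invmx A x (L m))).
  apply: eq_bigr => m _; rewrite !mxE -[in RHS]AE mxE; apply: eq_bigr => x _.
  by rewrite !mxE mulrC.
have -> : s * Num.sqrt (\det G) / 3`!%:R *
    \sum_(I : {ffun 'I_3 -> 'I_7}) wup I *
      \det (@col_mx R 3 4 7 (basis_rows I) (basis_rows K *m A))
  = s * Num.sqrt (\det G) / 3`!%:R * \det A *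
    \sum_(L : {ffun 'I_3 -> 'I_7}) g2_model L *
      \det (@col_mx R 3 4 7 (basis_rows L) (basis_rows K)).
  rewrite -[RHS]mulrA; congr (_ * _).
  under [X in _ = _ * X]eq_bigr => L _ do rewrite -frame_up big_distrl /=.
  rewrite exchange_big big_distrr; apply: eq_bigr => I _ /=.
  under [X in _ = _ * X]eq_bigr => L _ do rewrite -mulrA.
  rewrite -big_distrr /= mulrCA; congr (_ * _).
  have -> : @col_mx R 3 4 7 (basis_rows I) (basis_rows K *m A)
      = @col_mx R 3 4 7 (basis_rows I *m invmx A) (basis_rows K) *m A.
    by rewrite mul_col_mx mulmxKV.
  rewrite det_mulmx mulrC (@det_expand_up R 3 4); congr (_ * _); apply: eq_bigr => L _.
  congr (_ * _); apply: eq_bigr => m _.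
  rewrite !mxE (bigD1 (I m)) //= !mxE eqxx mul1r big1 ?addr0 // => x nx.
  by rewrite !mxE eq_sym (negPf nx) mul0r.
rewrite hodge_modelE ?rngS //.
have -> (x y : R) : s * Num.sqrt (\det G) / x * \det A * (x * y)
    = (s * Num.sqrt (\det G) * \det A) * (x / x) * y by ring.
by rewrite vol mul1r divff ?mul1r // pnatr_eq0.
Qed.

(** Pointwise form of the theorem of Fernandez and Gray that d phi = k psi and
    d psi = 0 determine nabla phi. Here nab p u v y stands for
    (nabla_p phi)(u, v, y), and dnab p u v y z for (nabla_p psi)(u, v, y, z); the
    hypothesis on cross products is the derivative of psi(u, v, u, z) = 0. *)
Lemma nabla_psi4 (nab : 'rV[R]_7 -> 'rV[R]_7 -> 'rV[R]_7 -> 'rV[R]_7 -> R) (k : R) :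
  (forall u v y, linear_form (fun p => nab p u v y)) ->
  (forall p v y, linear_form (fun u => nab p u v y)) ->
  (forall p u y, linear_form (fun v => nab p u v y)) ->
  (forall p u v, linear_form (fun y => nab p u v y)) ->
  (forall p u v y, nab p v u y = - nab p u v y) ->
  (forall p u v y, nab p u y v = - nab p u v y) ->
  (forall p u v z, nab p u v (cross G w u z) + nab p u z (cross G w u v) = 0) ->
  let dnab p u v y z := nab p u v (cross G w y z) + nab p y z (cross G w u v) in
  (forall u v y z, nab u v y z - nab v u y z + nab y u v z - nab z u v y
     = k * psi4 G w u v y z) ->
  (forall p u v y z, dnab p u v y z - dnab u p v y z + dnab v p u y z
     - dnab y p u v z + dnab z p u v y = 0) ->
  forall p u v y, nab p u v y = k / 4 * psi4 G w p u v y.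
Proof.
move=> L1 L2 L3 L4 C12 C23 nab_cross dnab dphi dpsi p u v y.
apply/eqP; rewrite -subr_eq0; apply/eqP.
apply: (@linear_form4_frame _ _ A
  (fun p u v y => nab p u v y - k / 4 * psi4 G w p u v y)) => //.
- by move=> * a ? ?; rewrite L1 psi4_lin1; ring.
- by move=> * a ? ?; rewrite L2 psi4_lin2; ring.
- by move=> * a ? ?; rewrite L3 psi4_lin3; ring.
- by move=> * a ? ?; rewrite L4 psi4_lin4; ring.
have nabZ p' i j a x : nab p' i j (a *: x) = a * nab p' i j x.
  exact: (linear_formZ _ _ (L4 p' i j)).
move=> p0 i0 j0 k0; rewrite !row_frame frame_psi4 ?rngS //; apply/eqP; rewrite subr_eq0.
apply/eqP; pose b p i j m := nab (e p) (e i) (e j) (e m).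
apply: (@nabla_psi_frame R b k); rewrite ?rngS // /b => *.
- exact: C12.
- exact: C23.
- by rewrite -!nabZ -!frame_cross // nab_cross.
- by rewrite dphi frame_psi4.
- by rewrite -!nabZ -!frame_cross //; exact: dpsi.
Qed.

End AdaptedFrame.

(** * Directional derivatives of finite expressions *)

Section DirectionalDerivative.
Context {R : realType} {n : nat}.
Variables (x v : 'rV[R]_n).
Implicit Types f g : 'rV[R]_n -> R.

Lemma is_der_cst (c : R) : is_derive x v (fun=> c) 0.
Proof. exact: is_derive_cst. Qed.

Lemma is_der_mul f g df dg : is_derive x v f df -> is_derive x v g dg ->
  is_derive x v (fun y => f y * g y) (df * g x + f x * dg).
Proof.
move=> Df Dg; apply: is_derive_eq (is_deriveM Df Dg) _.
by rewrite /GRing.scale /= addrC mulrC.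
Qed.

Lemma is_der_add f g df dg : is_derive x v f df -> is_derive x v g dg ->
  is_derive x v (fun y => f y + g y) (df + dg).
Proof. by move=> Df Dg; exact: is_deriveD. Qed.

Lemma is_der_opp f df : is_derive x v f df -> is_derive x v (fun y => - f y) (- df).
Proof. by move=> Df; exact: is_deriveN. Qed.

Lemma is_der_sum (I : finType) (F : I -> 'rV[R]_n -> R) (dF : I -> R) :
  (forall i, is_derive x v (F i) (dF i)) ->
  is_derive x v (fun y => \sum_i F i y) (\sum_i dF i).
Proof.
move=> DF; rewrite /index_enum; elim: (Finite.enum I) => [|i s IHs].
  rewrite big_nil; under [X in is_derive _ _ X]eq_fun do rewrite big_nil.
  exact: is_der_cst.
rewrite big_cons; under [X in is_derive _ _ X]eq_fun do rewrite big_cons.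
exact: is_der_add.
Qed.

Lemma derivable_prod (I : finType) (F : I -> 'rV[R]_n -> R) :
  (forall i, derivable (F i) x v) -> derivable (fun y => \prod_i F i y) x v.
Proof.
move=> DF; rewrite /index_enum; elim: (Finite.enum I) => [|i s IHs].
  under [X in derivable X]eq_fun do rewrite big_nil.
  exact: derivable_cst.
under [X in derivable X]eq_fun do rewrite big_cons.
exact: derivableM.
Qed.

Lemma derivable_fsum (I : finType) (F : I -> 'rV[R]_n -> R) :
  (forall i, derivable (F i) x v) -> derivable (fun y => \sum_i F i y) x v.
Proof.
move=> DF; have DF' i : is_derive x v (F i) ('D_v (F i) x) by exact: derivableP.
by have [] := is_der_sum DF'.
Qed.

Lemma derivable_det p (A : 'rV[R]_n -> 'M[R]_p) :
  (forall i j, derivable (fun y => A y i j) x v) -> derivable (fun y => \det (A y)) x v.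
Proof.
move=> DA; apply: derivable_fsum => s; apply: derivableM; first exact: derivable_cst.
exact: derivable_prod.
Qed.

(** Near x the inverse is given by the adjugate formula. *)
Lemma derivable_invmx p (A : 'rV[R]_n -> 'M[R]_p) :
  (\forall y \near x, A y \in unitmx) ->
  (forall i j, derivable (fun y => A y i j) x v) ->
  forall i j, derivable (fun y => invmx (A y) i j) x v.
Proof.
move=> Au DA i j.
have [-> | v0] := eqVneq v 0; first exact: derivable0.
apply: (@near_eq_derivable _ _ _ (fun y => (\det (A y))^-1 * cofactor (A y) j i)) => //.
  by near do rewrite /invmx ifT ?mxE //.
apply: derivableM.
  apply: derivableV; last exact: derivable_det.
  by rewrite -unitfE -unitmxE; exact: nbhs_singleton Au.
apply: derivableM; first exact: derivable_cst.
apply: derivable_det => k l; under eq_fun do rewrite !mxE; exact: DA.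
Unshelve. all: by end_near. Qed.

Definition is_der_row (u : 'rV[R]_n -> 'rV[R]_n) (du : 'rV[R]_n) :=
  forall k, is_derive x v (fun y => u y 0 k) (du 0 k).

Lemma is_der_row_cst u : is_der_row (fun=> u) 0.
Proof. by move=> k; rewrite mxE; exact: is_der_cst. Qed.

Lemma is_der_dot (G : 'rV[R]_n -> 'M[R]_n) (dG : 'M[R]_n) u du w dw :
  (forall i j, is_derive x v (fun y => G y i j) (dG i j)) ->
  is_der_row u du -> is_der_row w dw ->
  is_derive x v (fun y => dot (G y) (u y) (w y))
    (dot dG (u x) (w x) + dot (G x) du (w x) + dot (G x) (u x) dw).
Proof.
move=> DG Du Dw; under [X in is_derive _ _ X]eq_fun do rewrite dotE.
have D := is_der_sum (fun i => is_der_sum (fun j =>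
  is_der_mul (is_der_mul (DG i j) (Du i)) (Dw j))).
apply: is_derive_eq D _; rewrite !dotE -!big_split /=; apply: eq_bigr => i _.
by rewrite -!big_split /=; apply: eq_bigr => j _; ring.
Qed.

Lemma is_der_form3 (w : 'rV[R]_n -> {ffun 'I_3 -> 'I_n} -> R) dw u du u' du' u'' du'' :
  (forall I, is_derive x v (fun y => w y I) (dw I)) ->
  is_der_row u du -> is_der_row u' du' -> is_der_row u'' du'' ->
  is_derive x v (fun y => form3 (w y) (u y) (u' y) (u'' y))
    (form3 dw (u x) (u' x) (u'' x) + form3 (w x) du (u' x) (u'' x)
     + form3 (w x) (u x) du' (u'' x) + form3 (w x) (u x) (u' x) du'').
Proof.
move=> Dw D1 D2 D3; under [X in is_derive _ _ X]eq_fun do rewrite form3E.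
have D := is_der_sum (fun I => is_der_mul (Dw I)
  (is_der_mul (is_der_mul (D1 (I 0)) (D2 (I 1))) (D3 (I (lift 0 1))))).
apply: is_derive_eq D _; rewrite !form3E -!big_split /=; apply: eq_bigr => I _.
by ring.
Qed.

End DirectionalDerivative.

(** * Symmetry of second partial derivatives *)

Section Schwarz.
Context {R : realType} {n : nat}.
Implicit Types (f : 'rV[R]_n -> R) (x v : 'rV[R]_n).

Lemma is_derive_line f x v (s : R) : derivable f (x + s *: v) v ->
  is_derive s 1 (fun t => f (x + t *: v)) ('D_v f (x + s *: v)).
Proof.
have E : (fun h : R => h^-1 *: (f (x + (h *: 1 + s) *: v) - f (x + s *: v)))
    = (fun h : R => h^-1 *: (f (h *: v + (x + s *: v)) - f (x + s *: v))).
  by apply/funext => h; rewrite [h *: 1]mulr1 scalerDl addrCA.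
by move=> fd; split; rewrite /derivable /derive /= E.
Qed.

Lemma is_derive_translate f x v c : derivable f (x + c) v ->
  is_derive x v (fun y => f (y + c)) ('D_v f (x + c)).
Proof.
have E : (fun h : R => h^-1 *: (f (h *: v + x + c) - f (x + c)))
    = (fun h : R => h^-1 *: (f (h *: v + (x + c)) - f (x + c))).
  by apply/funext => h; rewrite addrA.
by move=> fd; split; rewrite /derivable /derive /= E.
Qed.

Lemma mean_value_line f x v (h : R) : 0 < h ->
  (forall s, 0 <= s <= h -> derivable f (x + s *: v) v) ->
  exists2 s, 0 <= s <= h & f (x + h *: v) - f x = 'D_v f (x + s *: v) * h.
Proof.
move=> h0 fd; pose g t := f (x + t *: v).
have gd s : s \in `[0, h] -> is_derive s 1 g ('D_v f (x + s *: v)).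
  by rewrite in_itv /= => /fd; exact: is_derive_line.
have gc : {within `[0, h], continuous g}.
  by apply: derivable_within_continuous => s /gd [].
have gd' s : s \in `]0, h[ -> is_derive s 1 g ('D_v f (x + s *: v)).
  by move=> /subset_itv_oo_cc; exact: gd.
have [s sh E] := MVT_segment (ltW h0) gd' gc.
by exists s; [move: sh; rewrite in_itv|move: E; rewrite /g scale0r addr0 subr0].
Qed.

(** Both second derivatives are mean values of the same second difference. *)
Lemma mean_value_square f x (i j : 'I_n) (h : R) : 0 < h ->
  let ei := delta_mx 0 i in let ej := delta_mx 0 j in
  (forall s t, 0 <= s <= h -> 0 <= t <= h ->
     derivable f (x + s *: ei + t *: ej) ei /\
     derivable (partial i f) (x + s *: ei + t *: ej) ej) ->
  exists s t, [/\ 0 <= s <= h, 0 <= t <= h &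
    f (x + h *: ei + h *: ej) - f (x + h *: ei) - f (x + h *: ej) + f x
    = partial j (partial i f) (x + s *: ei + t *: ej) * h * h].
Proof.
move=> h0 ei ej fd; have hh : 0 <= h <= h by rewrite lexx ltW.
have h00 : 0 <= (0 : R) <= h by rewrite lexx ltW.
pose g y := f (y + h *: ej) - f y.
have sE s : x + s *: ei + 0 *: ej = x + s *: ei by rewrite scale0r addr0.
have gd s : 0 <= s <= h -> is_derive (x + s *: ei) ei g
    (partial i f (x + s *: ei + h *: ej) - partial i f (x + s *: ei)).
  move=> sh; apply: is_der_add; last first.
    by apply: is_der_opp; apply: derivableP; rewrite -sE; exact: (fd s 0 sh h00).1.
  by apply: is_derive_translate; exact: (fd s h sh hh).1.
have [|s sh E] := mean_value_line h0 (f := g) (x := x) (v := ei).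
  by move=> s /gd [].
have [|t th E'] := mean_value_line h0 (f := partial i f) (x := x + s *: ei) (v := ej).
  by move=> t th; exact: (fd s t sh th).2.
exists s, t; split => //; have [_ D] := gd s sh; move: E; rewrite D E' => <-.
by rewrite /g; ring.
Qed.

(** By mean_value_square the two derivatives take equal values at points of
    arbitrarily small squares at x, and both are continuous at x. *)
Lemma partialC (V : set 'rV[R]_n) f x (i j : 'I_n) : open V -> V x -> smooth_on V f ->
  partial i (partial j f) x = partial j (partial i f) x.
Proof.
move=> Vo Vx fs; apply/eqP; rewrite -subr_eq0 -normr_le0; apply/ler_addgt0Pl => eps eps0.
rewrite addr0; have e0 : 0 < eps / 2 by rewrite divr_gt0.
pose p := partial i (partial j f); pose q := partial j (partial i f).
have : \forall y \near x, [/\ V y, `|p x - p y| < eps / 2 & `|q x - q y| < eps / 2].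
  have pc : {for x, continuous p} := (fs [:: i; j] x Vx).1.
  have qc : {for x, continuous q} := (fs [:: j; i] x Vx).1.
  have close r : {for x, continuous r} -> \forall y \near x, `|r x - r y| < eps / 2.
    by move=> /cvgrPdist_lt; exact.
  move: p q pc qc => p q pc qc.
  by near=> y; split; near: y; [exact: open_nbhs_nbhs|exact: close|exact: close].
case/nbhs_ballP => d /= d0 dP.
pose ei : 'rV[R]_n := delta_mx 0 i; pose ej : 'rV[R]_n := delta_mx 0 j.
pose c := `|ei| + `|ej| + 1; have c0 : 0 < c by rewrite ltr_wpDl // addr_ge0.
pose h := d / (2 * c); have h0 : 0 < h by rewrite divr_gt0 // mulr_gt0.
have box s t : 0 <= s <= h -> 0 <= t <= h ->
    [/\ V (x + s *: ei + t *: ej), `|p x - p (x + s *: ei + t *: ej)| < eps / 2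
      & `|q x - q (x + s *: ei + t *: ej)| < eps / 2].
  move=> /andP[s0 sh] /andP[t0 th]; apply: dP.
  rewrite /= -ball_normE /= -addrA opprD addNKr.
  rewrite normrN (le_lt_trans (ler_normD _ _)) // !normrZ !ger0_norm //.
  apply: (@le_lt_trans _ _ (h * c)).
    rewrite /c !mulrDr mulr1 -addrA lerD ?ler_wpM2r //.
    by rewrite (le_trans (ler_wpM2r _ th)) // lerDl ltW.
  have -> : h * c = d / 2 by rewrite /h; field; rewrite gt_eqF.
  by rewrite /=; have := d0; rewrite /=; lra.
have smoothd s t : 0 <= s <= h -> 0 <= t <= h -> forall k l,
    derivable f (x + s *: ei + t *: ej) (delta_mx 0 k) /\
    derivable (partial k f) (x + s *: ei + t *: ej) (delta_mx 0 l).
  move=> sh th k l; have [Vy _ _] := box s t sh th.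
  by split; [exact: (fs [::] _ Vy).2 | exact: (fs [:: k] _ Vy).2].
have [|s [t [sh th E]]] := @mean_value_square f x i j h h0.
  by move=> s t sh th; exact: smoothd.
have [|t' [s' [th' sh' E']]] := @mean_value_square f x j i h h0.
  by move=> t1 s1 th1 sh1; rewrite addrAC; exact: smoothd.
have pq : p (x + s' *: ei + t' *: ej) = q (x + s *: ei + t *: ej).
  have hn : h != 0 by rewrite gt_eqF.
  apply: (mulIf hn); apply: (mulIf hn); rewrite [x + s' *: ei + _]addrAC.
  apply: etrans (esym E') _; apply: etrans E.
  by rewrite [x + h *: ej + h *: ei]addrAC; ring.
have [_ _ qb] := box _ _ sh th; have [_ pb _] := box _ _ sh' th'.
suff : `|p x - q x| <= eps by [].
move: pb qb; rewrite pq; move: (p x) (q x) (q _) => a b r ar br.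
apply: (le_trans (ler_distD r a b)).
rewrite distrC in br.
have -> : eps = eps / 2 + eps / 2 by exact: splitr.
by apply: lerD; exact: ltW.
Unshelve. all: by end_near. Qed.

End Schwarz.

(** * Exterior derivatives in components *)

Section ExteriorDerivative.
Context {R : realType} {n : nat}.
Implicit Types (x : 'rV[R]_n) (w : 'rV[R]_n -> {ffun 'I_3 -> 'I_n} -> R).

Definition mk5 (i j k l m : 'I_n) : {ffun 'I_5 -> 'I_n} :=
  [ffun r => tnth [tuple i; j; k; l; m] r].

Lemma ext_d3E w x i j k l : ext_d w x (mk4 i j k l) =
  partial i (fun y => w y (mk3 j k l)) x - partial j (fun y => w y (mk3 i k l)) x
  + partial k (fun y => w y (mk3 i j l)) x - partial l (fun y => w y (mk3 i j k)) x.
Proof.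
have E (r : 'I_4) (I : {ffun 'I_3 -> 'I_n}) :
    (forall m : 'I_3, tnth [tuple i; j; k; l] (lift r m) = I m) ->
    [ffun m => mk4 i j k l (lift r m)] = I.
  by move=> H; apply/ffunP => m; rewrite !ffunE.
rewrite /ext_d !big_ord_recl big_ord0 !ffunE !(tnth_nth i) /= /bump /=.
rewrite (E _ (mk3 j k l)); last by case=> -[|[|[|]]] // ?; rewrite !ffunE !(tnth_nth i).
rewrite (E _ (mk3 i k l)); last by case=> -[|[|[|]]] // ?; rewrite !ffunE !(tnth_nth i).
rewrite (E _ (mk3 i j l)); last by case=> -[|[|[|]]] // ?; rewrite !ffunE !(tnth_nth i).
rewrite (E _ (mk3 i j k)); last by case=> -[|[|[|]]] // ?; rewrite !ffunE !(tnth_nth i).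
by ring.
Qed.

Lemma ext_d4E (w : 'rV[R]_n -> {ffun 'I_4 -> 'I_n} -> R) x i j k l m :
  ext_d w x (mk5 i j k l m) =
  partial i (fun y => w y (mk4 j k l m)) x - partial j (fun y => w y (mk4 i k l m)) x
  + partial k (fun y => w y (mk4 i j l m)) x - partial l (fun y => w y (mk4 i j k m)) x
  + partial m (fun y => w y (mk4 i j k l)) x.
Proof.
have E (r : 'I_5) (I : {ffun 'I_4 -> 'I_n}) :
    (forall q : 'I_4, tnth [tuple i; j; k; l; m] (lift r q) = I q) ->
    [ffun q => mk5 i j k l m (lift r q)] = I.
  by move=> H; apply/ffunP => q; rewrite !ffunE.
rewrite /ext_d !big_ord_recl big_ord0 !ffunE !(tnth_nth i) /= /bump /=.
rewrite (E _ (mk4 j k l m)); last by case=> -[|[|[|[|]]]] // ?; rewrite !ffunE !(tnth_nth i).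
rewrite (E _ (mk4 i k l m)); last by case=> -[|[|[|[|]]]] // ?; rewrite !ffunE !(tnth_nth i).
rewrite (E _ (mk4 i j l m)); last by case=> -[|[|[|[|]]]] // ?; rewrite !ffunE !(tnth_nth i).
rewrite (E _ (mk4 i j k m)); last by case=> -[|[|[|[|]]]] // ?; rewrite !ffunE !(tnth_nth i).
rewrite (E _ (mk4 i j k l)); last by case=> -[|[|[|[|]]]] // ?; rewrite !ffunE !(tnth_nth i).
by ring.
Qed.

(** In degree 3: the twenty second derivatives cancel in pairs. *)
Lemma ext_d_ext_d (V : set 'rV[R]_n) w x i j k l m : open V -> V x ->
  (forall I, smooth_on V (fun y => w y I)) ->
  ext_d (fun y => ext_d w y) x (mk5 i j k l m) = 0.
Proof.
move=> Vo Vx ws; rewrite ext_d4E.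
have D r a b c d : partial r (fun y => ext_d w y (mk4 a b c d)) x =
    partial r (partial a (fun y => w y (mk3 b c d))) x
    - partial r (partial b (fun y => w y (mk3 a c d))) x
    + partial r (partial c (fun y => w y (mk3 a b d))) x
    - partial r (partial d (fun y => w y (mk3 a b c))) x.
  have D1 p I : is_derive x (delta_mx 0 r) (partial p (fun y => w y I))
      (partial r (partial p (fun y => w y I)) x).
    by apply: derivableP; exact: (ws I [:: p] x Vx).2.
  have -> : (fun y => ext_d w y (mk4 a b c d)) = (fun y =>
     partial a (fun y => w y (mk3 b c d)) y + - partial b (fun y => w y (mk3 a c d)) y
     + partial c (fun y => w y (mk3 a b d)) y + - partial d (fun y => w y (mk3 a b c)) y).
    by apply/funext => y; rewrite ext_d3E.
  have [_ E] := is_der_add (is_der_add (is_der_add (D1 a (mk3 b c d))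
    (is_der_opp (D1 b (mk3 a c d)))) (D1 c (mk3 a b d))) (is_der_opp (D1 d (mk3 a b c))).
  exact: E.
have [P PE] : exists P : 'I_n -> 'I_n -> {ffun 'I_3 -> 'I_n} -> R,
    forall p q I, partial p (partial q (fun y => w y I)) x = P p q I.
  by exists (fun p q I => partial p (partial q (fun y => w y I)) x).
have C p q I : P p q I = P q p I by rewrite -!PE; exact: partialC Vo Vx (ws I).
rewrite !D !PE (C i j) (C i k) (C i l) (C i m) (C j k) (C j l) (C j m) (C k l).
rewrite (C k m) (C l m).
move: (mk3 _ _ _) (mk3 _ _ _) (mk3 _ _ _) (mk3 _ _ _) (mk3 _ _ _) => *.
move: (mk3 _ _ _) (mk3 _ _ _) (mk3 _ _ _) (mk3 _ _ _) (mk3 _ _ _) => *.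
by ring.
Qed.

End ExteriorDerivative.

(** * The covariant derivative of a G2 structure in a chart *)

Section ChartNabla.
Variables (R : realType) (M : manifold R 7) (S : g2_structure M).
Variables (a : atlas_index M) (x : 'rV[R]_7) (ax : chart_img (atlas a) x).

Let G := g2_metric S a.
Let w := g2_form S a.
Let V := chart_img (atlas a).

Let V_open : open V. Proof. exact: chart_img_open. Qed.

Let near_V : \forall y \near x, V y.
Proof. by apply: open_nbhs_nbhs; split. Qed.

Let Gsym y : V y -> (G y)^T = G y. Proof. exact: rm_sym. Qed.

Let Gunit y : V y -> G y \in unitmx.
Proof. by move=> Vy; apply: dot_pos_unit; exact: rm_pos. Qed.

Let walt y : V y -> alternating (w y). Proof. exact: df_alt. Qed.

(** The connection matrices: nabla_m u = d_m u + u *m conn m. *)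
Definition conn (m : 'I_7) : 'M[R]_7 := \matrix_(i, k) christoffel G x m i k.

Lemma covariantE (X Y : 'rV[R]_7 -> 'rV[R]_7) : covariant G X Y x =
  \sum_m X x 0 m *: (\row_k partial m (fun y => Y y 0 k) x + Y x *m conn m).
Proof.
apply/rowP => k; rewrite mxE summxE -big_split; apply: eq_bigr => m _ /=.
rewrite !mxE mulrDr; congr (_ + _); rewrite big_distrr; apply: eq_bigr => j _ /=.
by rewrite !mxE; ring.
Qed.

(** The connection is torsion free. *)
Lemma connC i j : (delta_mx 0 j : 'rV_7) *m conn i = (delta_mx 0 i : 'rV_7) *m conn j.
Proof. by apply/rowP => k; rewrite -!rowE !mxE; exact: christoffel_torsion_free. Qed.

Lemma is_der_metric m i j : is_derive x (delta_mx 0 m) (fun y => G y i j)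
  ((conn m *m G x + G x *m (conn m)^T) i j).
Proof.
have d : derivable (fun y => G y i j) x (delta_mx 0 m).
  exact: (rm_smooth (g2_metric S) i j [::] ax).2.
apply: is_derive_eq (derivableP d) _; rewrite -/(partial _ _ _) christoffel_metric //.
rewrite !mxE; congr (_ + _); apply: eq_bigr => k _; rewrite !mxE //.
by rewrite mulrC.
Qed.

Definition form_partial m (I : {ffun 'I_3 -> 'I_7}) : R :=
  partial m (fun y => w y I) x.

Lemma is_der_form m I : is_derive x (delta_mx 0 m) (fun y => w y I) (form_partial m I).
Proof. by apply: derivableP; exact: (df_smooth (g2_form S) I [::] ax).2. Qed.

Lemma is_der_metric_dot m u du z dz :
  is_der_row x (delta_mx 0 m) u du -> is_der_row x (delta_mx 0 m) z dz ->
  is_derive x (delta_mx 0 m) (fun y => dot (G y) (u y) (z y))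
    (dot (G x) (du + u x *m conn m) (z x) + dot (G x) (u x) (dz + z x *m conn m)).
Proof.
move=> Du Dz; apply: is_derive_eq (is_der_dot (is_der_metric m) Du Dz) _.
have -> : dot (conn m *m G x + G x *m (conn m)^T) (u x) (z x)
    = dot (G x) (u x *m conn m) (z x) + dot (G x) (u x) (z x *m conn m).
  by rewrite /dot mulmxDr mulmxDl mxE trmx_mul !mulmxA.
rewrite (linear_formD _ _ (dot_linl _ _)) (linear_formD _ _ (dot_linr _ _)).
by ring.
Qed.

(** Derivative of |Y|^2 = 1, as the connection is metric. *)
Lemma unit_covariant_orth (X Y : 'rV[R]_7 -> 'rV[R]_7) :
  (forall k, smooth_on V (fun y => Y y 0 k)) ->
  (forall y, V y -> dot (G y) (Y y) (Y y) = 1) ->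
  dot (G x) (covariant G X Y x) (Y x) = 0.
Proof.
move=> Ys Y1; rewrite covariantE (linear_form_sum _ (dot_linl _ _)).
apply: big1 => m _; rewrite dotZl.
have DY : is_der_row x (delta_mx 0 m) Y (\row_k partial m (fun y => Y y 0 k) x).
  by move=> r; rewrite mxE; apply: derivableP; exact: (Ys r [::] x ax).2.
have [_ E] := is_der_metric_dot DY DY.
have : 'D_(delta_mx 0 m) (fun y => dot (G y) (Y y) (Y y)) x = 0.
  rewrite -(derive_cst (1 : R) x (delta_mx 0 m)); apply: near_eq_derive.
  by apply: filterS near_V => y /Y1.
rewrite {}E [X in _ + X]dotC ?Gsym // => /eqP.
by rewrite -mulr2n mulrn_eq0 /= => /eqP ->; rewrite mulr0.
Qed.

(** (nabla_m phi)(u, v, z) for constant u, v, z. *)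
Definition nabla_basis m (u v z : 'rV[R]_7) : R :=
  form3 (form_partial m) u v z
  - form3 (w x) (u *m conn m) v z - form3 (w x) u (v *m conn m) z
  - form3 (w x) u v (z *m conn m).

Definition nabla_form (p u v z : 'rV[R]_7) : R :=
  \sum_m p 0 m * nabla_basis m u v z.

Lemma nabla_form_delta m u v z : nabla_form (delta_mx 0 m) u v z = nabla_basis m u v z.
Proof.
rewrite /nabla_form (bigD1 m) //= mxE !eqxx mul1r big1 ?addr0 // => i /negPf im.
by rewrite mxE eqxx im mul0r.
Qed.

Lemma nabla_form_lin1 u v z : linear_form (fun p => nabla_form p u v z).
Proof.
move=> c p p'; rewrite /nabla_form mulr_sumr -big_split; apply: eq_bigr => m _ /=.
by rewrite !mxE; ring.
Qed.

Lemma nabla_form_lin2 p v z : linear_form (fun u => nabla_form p u v z).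
Proof.
move=> c u u'; rewrite /nabla_form mulr_sumr -big_split; apply: eq_bigr => m _ /=.
by rewrite /nabla_basis mulmxDl -scalemxAl !form3_lin1; ring.
Qed.

Lemma nabla_form_lin3 p u z : linear_form (fun v => nabla_form p u v z).
Proof.
move=> c v v'; rewrite /nabla_form mulr_sumr -big_split; apply: eq_bigr => m _ /=.
by rewrite /nabla_basis mulmxDl -scalemxAl !form3_lin2; ring.
Qed.

Lemma nabla_form_lin4 p u v : linear_form (fun z => nabla_form p u v z).
Proof.
move=> c z z'; rewrite /nabla_form mulr_sumr -big_split; apply: eq_bigr => m _ /=.
by rewrite /nabla_basis mulmxDl -scalemxAl !form3_lin3; ring.
Qed.

Let dw_alt m : alternating (form_partial m).
Proof.
move=> I s; transitivity (partial m (fun y => (-1) ^+ s * w y I) x).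
  by apply: near_eq_derive; apply: filterS near_V => y Vy; exact: walt.
have [_ E] := is_der_mul (is_der_cst x (delta_mx 0 m) ((-1) ^+ s)) (is_der_form m I).
by rewrite /partial E mul0r add0r.
Qed.

Lemma nabla_formC12 p u v z : nabla_form p v u z = - nabla_form p u v z.
Proof.
rewrite /nabla_form -sumrN; apply: eq_bigr => m _; rewrite -mulrN; congr (_ * _).
have C u' v' z' := form3C12 u' v' z' (walt ax).
rewrite /nabla_basis (form3C12 _ _ _ (dw_alt m)) (C u (v *m _)) (C (u *m _) v) (C u v).
by ring.
Qed.

Lemma nabla_formC23 p u v z : nabla_form p u z v = - nabla_form p u v z.
Proof.
rewrite /nabla_form -sumrN; apply: eq_bigr => m _; rewrite -mulrN; congr (_ * _).
have C u' v' z' := form3C23 u' v' z' (walt ax).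
rewrite /nabla_basis (form3C23 _ _ _ (dw_alt m)).
rewrite (C _ v z) (C u v (z *m _)) (C u (v *m _) z).
by ring.
Qed.

Lemma is_der_form3_nabla m u du v dv z dz :
  is_der_row x (delta_mx 0 m) u du -> is_der_row x (delta_mx 0 m) v dv ->
  is_der_row x (delta_mx 0 m) z dz ->
  is_derive x (delta_mx 0 m) (fun y => form3 (w y) (u y) (v y) (z y))
    (nabla_basis m (u x) (v x) (z x) + form3 (w x) (du + u x *m conn m) (v x) (z x)
     + form3 (w x) (u x) (dv + v x *m conn m) (z x)
     + form3 (w x) (u x) (v x) (dz + z x *m conn m)).
Proof.
move=> Du Dv Dz; apply: is_derive_eq (is_der_form3 (is_der_form m) Du Dv Dz) _.
rewrite (linear_formD _ _ (form3_lin1 _ _ _)) (linear_formD _ _ (form3_lin2 _ _ _)).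
rewrite (linear_formD _ _ (form3_lin3 _ _ _)) /nabla_basis.
by ring.
Qed.

(** The Leibniz rule for the cross product, whose covariant derivative is dual to
    that of the 3-form. *)
Lemma cross_derivative m u du v dv :
  is_der_row x (delta_mx 0 m) u du -> is_der_row x (delta_mx 0 m) v dv ->
  let c y := cross (G y) (w y) (u y) (v y) in
  let dc := \row_k partial m (fun y => c y 0 k) x in
  is_der_row x (delta_mx 0 m) c dc /\
  forall z, dot (G x) (dc + c x *m conn m) z =
    nabla_basis m (u x) (v x) z
    + dot (G x) (cross (G x) (w x) (du + u x *m conn m) (v x)) z
    + dot (G x) (cross (G x) (w x) (u x) (dv + v x *m conn m)) z.
Proof.
move=> Du Dv c dc.
have Dc : is_der_row x (delta_mx 0 m) c dc.
  move=> k; rewrite mxE; apply: derivableP.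
  rewrite (_ : (fun y => c y 0 k) = fun y =>
    \sum_i form3 (w y) (u y) (v y) (delta_mx 0 i) * invmx (G y) i k); last first.
    by apply/funext => y; rewrite mxE; apply: eq_bigr => i _; rewrite mxE.
  apply: derivable_fsum => i; apply: derivableM.
    by have [] := is_der_form3_nabla Du Dv (is_der_row_cst _ _ (delta_mx 0 i)).
  apply: derivable_invmx; first by apply: filterS near_V => y; exact: Gunit.
  by move=> r s; have [] := is_der_metric m r s.
split=> // z; have Dz := is_der_row_cst x (delta_mx 0 m) z.
have [_ E1] := is_der_metric_dot Dc Dz.
have [_ E2] := is_der_form3_nabla Du Dv Dz.
have E : 'D_(delta_mx 0 m) (fun y => dot (G y) (c y) z) x
    = 'D_(delta_mx 0 m) (fun y => form3 (w y) (u y) (v y) z) x.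
  by apply: near_eq_derive; apply: filterS near_V => y Vy; exact: cross_dot (Gunit Vy).
move: E; rewrite E1 E2 !cross_dot ?Gunit //.
rewrite !add0r => /eqP; rewrite -subr_eq0 => /eqP E; apply/eqP; rewrite -subr_eq0 -{}E.
by apply/eqP; ring.
Qed.

Let psi := psi4 (G x) (w x).
Let crs := cross (G x) (w x).

Let psi4C13V y u v z t : V y ->
  psi4 (G y) (w y) z v u t = - psi4 (G y) (w y) u v z t.
Proof.
move=> Vy; have [A Aw] := g2_adapted S Vy.
exact: psi4C13 (Gunit Vy) Aw (g2_metricP Vy Aw) _ _ _ _.
Qed.

Let starE y i j k l : V y -> g2_star S a y (mk4 i j k l) =
  psi4 (G y) (w y) (delta_mx 0 i) (delta_mx 0 j) (delta_mx 0 k) (delta_mx 0 l).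
Proof.
move=> Vy; have [A Aw] := g2_adapted S Vy.
by apply: (hodge_psi4 (Gunit Vy) Aw (g2_metricP Vy Aw));
  [exact: or_unit | exact: g2_orientP].
Qed.

(** (nabla_p psi)(u, v, y, z), by the Leibniz rule applied to psi4; the metric
    does not contribute, as it is parallel. *)
Definition nabla_star (p u v y z : 'rV[R]_7) : R :=
  nabla_form p u v (crs y z) + nabla_form p y z (crs u v).

Lemma is_der_psi4 m u v y z :
  is_derive x (delta_mx 0 m) (fun t => psi4 (G t) (w t) u v y z)
    (nabla_star (delta_mx 0 m) u v y z
     + psi (u *m conn m) v y z + psi u (v *m conn m) y z
     + psi u v (y *m conn m) z + psi u v y (z *m conn m)).
Proof.
have C t := is_der_row_cst x (delta_mx 0 m) t.
have [D1 E1] := cross_derivative (C u) (C v).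
have [D2 E2] := cross_derivative (C y) (C z).
apply: is_derive_eq (is_der_add (is_der_add (is_der_metric_dot D1 D2)
  (is_der_opp (is_der_mul (is_der_metric_dot (C u) (C y)) (is_der_metric_dot (C v) (C z)))))
  (is_der_mul (is_der_metric_dot (C u) (C z)) (is_der_metric_dot (C v) (C y)))) _.
have {}E2 t := etrans (dotC t _ (Gsym ax)) (E2 t).
rewrite E1 E2 !add0r /nabla_star !nabla_form_delta.
rewrite /psi /psi4 /crs.
have S1 := dotC (cross (G x) (w x) u v) (cross (G x) (w x) (y *m conn m) z) (Gsym ax).
have S2 := dotC (cross (G x) (w x) u v) (cross (G x) (w x) y (z *m conn m)) (Gsym ax).
rewrite S1 S2.
by ring.
Qed.

Let psiC12 u v y z : psi v u y z = - psi u v y z.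
Proof. exact: psi4C12 (walt ax). Qed.

Let psiC34 u v y z : psi u v z y = - psi u v y z.
Proof. exact: psi4C34 (walt ax). Qed.

Let psiC13 u v y z : psi y v u z = - psi u v y z.
Proof. exact: psi4C13V. Qed.

Let psiC23 u v y z : psi u y v z = - psi u v y z.
Proof. by rewrite psiC12 (psiC13 v) psiC12 opprK. Qed.

(** The derivative of psi(u, v, u, z) = 0. It confines nabla_p phi to a
    7-dimensional space of 3-forms. *)
Lemma nabla_form_cross p u v z :
  nabla_form p u v (crs u z) + nabla_form p u z (crs u v) = 0.
Proof.
apply: (@linear_form_frame _ _ 1%:M (fun p => nabla_form p u v (crs u z)
  + nabla_form p u z (crs u v))) p; rewrite ?unitmx1 //.
  by move=> c p p'; rewrite !nabla_form_lin1; ring.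
move=> m; rewrite rowE mulmx1 -/(nabla_star (delta_mx 0 m) u v u z).
have [_ E] := is_der_psi4 m u v u z.
have : 'D_(delta_mx 0 m) (fun t => psi4 (G t) (w t) u v u z) x = 0.
  rewrite -(derive_cst (0 : R) x (delta_mx 0 m)); apply: near_eq_derive.
  apply: filterS near_V => t Vt; have := psi4C13V u v u z Vt.
  by move=> H; change (psi4 (G t) (w t) u v u z = 0); lra.
rewrite E; have := psiC13 u (v *m conn m) u z; have := psiC13 u v u (z *m conn m).
by have := psiC13 u v (u *m conn m) z; lra.
Qed.

(** The exterior derivative is the alternation of nabla, since the connection
    terms cancel by torsion-freeness. *)
Lemma ext_d_form i j k l : ext_d w x (mk4 i j k l) =
  nabla_form (delta_mx 0 i) (delta_mx 0 j) (delta_mx 0 k) (delta_mx 0 l)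
  - nabla_form (delta_mx 0 j) (delta_mx 0 i) (delta_mx 0 k) (delta_mx 0 l)
  + nabla_form (delta_mx 0 k) (delta_mx 0 i) (delta_mx 0 j) (delta_mx 0 l)
  - nabla_form (delta_mx 0 l) (delta_mx 0 i) (delta_mx 0 j) (delta_mx 0 k).
Proof.
have -> : ext_d w x (mk4 i j k l) = form_partial i (mk3 j k l)
    - form_partial j (mk3 i k l) + form_partial k (mk3 i j l) - form_partial l (mk3 i j k).
  exact: ext_d3E.
pose T r p q s := form3 (w x) (delta_mx 0 p *m conn r) (delta_mx 0 q) (delta_mx 0 s).
have TC r p q s : T r p q s = T p r q s by rewrite /T connC.
have E r p q s : nabla_form (delta_mx 0 r) (delta_mx 0 p) (delta_mx 0 q) (delta_mx 0 s)
    = form_partial r (mk3 p q s) - T r p q s + T r q p s - T r s p q.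
  rewrite nabla_form_delta /nabla_basis form3_delta -!/(T _ _ _ _).
  have C12 t u v := form3C12 t u v (walt ax).
  have C23 t u v := form3C23 t u v (walt ax).
  rewrite (C12 (delta_mx 0 q *m _)) (C23 (delta_mx 0 p) (delta_mx 0 s *m _)).
  by rewrite (C12 (delta_mx 0 s *m _)) !opprK.
move: T TC E => T TC E; rewrite !{}E; move: form_partial => P.
rewrite (TC i j) (TC i k) (TC i l) (TC j k) (TC j l) (TC k l).
by ring.
Qed.

Lemma partial_star m i j k l :
  derivable (fun y => g2_star S a y (mk4 i j k l)) x (delta_mx 0 m) /\
  partial m (fun y => g2_star S a y (mk4 i j k l)) x =
    (nabla_star (delta_mx 0 m) (delta_mx 0 i) (delta_mx 0 j) (delta_mx 0 k) (delta_mx 0 l)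
     + psi (delta_mx 0 i *m conn m) (delta_mx 0 j) (delta_mx 0 k) (delta_mx 0 l)
     - psi (delta_mx 0 j *m conn m) (delta_mx 0 i) (delta_mx 0 k) (delta_mx 0 l)
     + psi (delta_mx 0 k *m conn m) (delta_mx 0 i) (delta_mx 0 j) (delta_mx 0 l)
     - psi (delta_mx 0 l *m conn m) (delta_mx 0 i) (delta_mx 0 j) (delta_mx 0 k)).
Proof.
set ei := delta_mx 0 i; set ej := delta_mx 0 j; set ek := delta_mx 0 k.
set el := delta_mx 0 l.
have D : is_derive x (delta_mx 0 m) (fun y => g2_star S a y (mk4 i j k l))
    (nabla_star (delta_mx 0 m) ei ej ek el
     + psi (ei *m conn m) ej ek el + psi ei (ej *m conn m) ek el
     + psi ei ej (ek *m conn m) el + psi ei ej ek (el *m conn m)).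
  apply: near_eq_is_derive (is_der_psi4 m ei ej ek el).
  by apply: filterS near_V => y Vy; rewrite starE.
case: D => D E; split=> //; rewrite /partial {}E.
rewrite (psiC12 (ej *m _) ei) (psiC23 ei (ek *m _) ej) (psiC12 (ek *m _) ei ej).
rewrite (psiC34 ei ej (el *m _) ek) (psiC23 ei (el *m _) ej) (psiC12 (el *m _) ei ej).
do 4![move: (psi _ _ _ _) => ?]; move: (nabla_star _ _ _ _ _) => ?.
by ring.
Qed.

Lemma ext_d_star i j k l m : ext_d (g2_star S a) x (mk5 i j k l m) =
  nabla_star (delta_mx 0 i) (delta_mx 0 j) (delta_mx 0 k) (delta_mx 0 l) (delta_mx 0 m)
  - nabla_star (delta_mx 0 j) (delta_mx 0 i) (delta_mx 0 k) (delta_mx 0 l) (delta_mx 0 m)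
  + nabla_star (delta_mx 0 k) (delta_mx 0 i) (delta_mx 0 j) (delta_mx 0 l) (delta_mx 0 m)
  - nabla_star (delta_mx 0 l) (delta_mx 0 i) (delta_mx 0 j) (delta_mx 0 k) (delta_mx 0 m)
  + nabla_star (delta_mx 0 m) (delta_mx 0 i) (delta_mx 0 j) (delta_mx 0 k) (delta_mx 0 l).
Proof.
pose T r p q s t := psi (delta_mx 0 p *m conn r) (delta_mx 0 q) (delta_mx 0 s) (delta_mx 0 t).
have TC r p q s t : T r p q s t = T p r q s t by rewrite /T connC.
pose N r p q s t := nabla_star (delta_mx 0 r) (delta_mx 0 p) (delta_mx 0 q)
  (delta_mx 0 s) (delta_mx 0 t).
have E r p q s t : partial r (fun y => g2_star S a y (mk4 p q s t)) x
    = N r p q s t + T r p q s t - T r q p s t + T r s p q t - T r t p q s.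
  exact: (partial_star r p q s t).2.
rewrite ext_d4E !{}E -!/(N _ _ _ _ _); move: T TC N => T TC N.
rewrite (TC i j) (TC i k) (TC i l) (TC i m) (TC j k) (TC j l).
rewrite (TC j m) (TC k l) (TC k m) (TC l m).
by ring.
Qed.

Let crs_linl c u u' v : crs (c *: u + u') v = c *: crs u v + crs u' v.
Proof. exact: cross_linl. Qed.

Let crs_linr c u v v' : crs u (c *: v + v') = c *: crs u v + crs u v'.
Proof. exact: cross_linr. Qed.

Lemma nabla_star_lin1 u v y z : linear_form (fun p => nabla_star p u v y z).
Proof. by move=> c p p'; rewrite /nabla_star !nabla_form_lin1; ring. Qed.

Lemma nabla_star_lin2 p v y z : linear_form (fun u => nabla_star p u v y z).
Proof.
by move=> c u u'; rewrite /nabla_star crs_linl nabla_form_lin2 nabla_form_lin4; ring.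
Qed.

Lemma nabla_star_lin3 p u y z : linear_form (fun v => nabla_star p u v y z).
Proof.
by move=> c v v'; rewrite /nabla_star crs_linr nabla_form_lin3 nabla_form_lin4; ring.
Qed.

Lemma nabla_star_lin4 p u v z : linear_form (fun y => nabla_star p u v y z).
Proof.
by move=> c y y'; rewrite /nabla_star crs_linl nabla_form_lin2 nabla_form_lin4; ring.
Qed.

Lemma nabla_star_lin5 p u v y : linear_form (fun z => nabla_star p u v y z).
Proof.
by move=> c z z'; rewrite /nabla_star crs_linr nabla_form_lin3 nabla_form_lin4; ring.
Qed.

Section NearlyParallel.
Variable k : R.
Hypothesis dphi : forall y, V y -> forall J, ext_d w y J = k * g2_star S a y J.
Hypothesis dstar : k = 0 -> forall J, ext_d (g2_star S a) x J = 0.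

(** For k <> 0 the dual form is closed because k d psi = d (d phi) = 0. *)
Lemma ext_d_star0 i j l m n : ext_d (g2_star S a) x (mk5 i j l m n) = 0.
Proof.
have [/dstar -> //|k0] := eqVneq k 0.
apply: (mulfI k0); rewrite mulr0.
have ws I : smooth_on V (fun y => w y I) by exact: df_smooth.
pose P r K := partial r (fun y => g2_star S a y K) x.
pose Q r K := partial r (fun y => ext_d w y K) x.
have E r p q s t : k * P r (mk4 p q s t) = Q r (mk4 p q s t).
  transitivity (partial r (fun y => k * g2_star S a y (mk4 p q s t)) x).
    have D := derivableP (partial_star r p q s t).1.
    have [_ Ek] := is_der_mul (is_der_cst x (delta_mx 0 r) k) D.
    by rewrite /partial Ek mul0r add0r.
  by apply: near_eq_derive; apply: filterS near_V => y Vy; rewrite dphi.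
have -> : ext_d (g2_star S a) x (mk5 i j l m n) = P i (mk4 j l m n) - P j (mk4 i l m n)
    + P l (mk4 i j m n) - P m (mk4 i j l n) + P n (mk4 i j l m).
  exact: ext_d4E.
transitivity (Q i (mk4 j l m n) - Q j (mk4 i l m n) + Q l (mk4 i j m n)
    - Q m (mk4 i j l n) + Q n (mk4 i j l m)).
  by rewrite -!E; move: {E} P => P; ring.
rewrite -(ext_d_ext_d i j l m n V_open ax ws); exact: esym (ext_d4E _ _ _ _ _ _ _).
Qed.

(** The torsion of a nearly parallel structure: nabla phi = (k / 4) psi. *)
Lemma nabla_form_psi4 p u v z : nabla_form p u v z = k / 4 * psi p u v z.
Proof.
have [A Aw] := g2_adapted S ax.
have AG := g2_metricP ax Aw.
apply: (nabla_psi4 (Gunit ax) Aw AG nabla_form_lin1 nabla_form_lin2 nabla_form_lin3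
  nabla_form_lin4 nabla_formC12 nabla_formC23 nabla_form_cross) => {p u v z}.
- move=> u v y z; apply/eqP; rewrite -subr_eq0; apply/eqP; move: u v y z.
  apply: (alternation4_delta nabla_form_lin1 nabla_form_lin2 nabla_form_lin3
    nabla_form_lin4 (@psi4_lin1 _ _ _) (@psi4_lin2 _ _ _) (@psi4_lin3 _ _ _)
    (@psi4_lin4 _ _ _)) => i j l m.
  by rewrite -ext_d_form dphi // starE // subrr.
apply: (alternation5_delta nabla_star_lin1 nabla_star_lin2 nabla_star_lin3
  nabla_star_lin4 nabla_star_lin5) => i j l m n.
by rewrite -ext_d_star ext_d_star0.
Qed.

(** By the Leibniz rule the two sides differ by the dual of (nabla_X phi)(X, Y, .),
    which is a multiple of psi(X, X, Y, .) = 0. *)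
Lemma covariant_cross (X Y : 'rV[R]_7 -> 'rV[R]_7) :
  (forall k, smooth_on V (fun y => X y 0 k)) ->
  (forall k, smooth_on V (fun y => Y y 0 k)) ->
  covariant G X (fun y => cross (G y) (w y) (X y) (Y y)) x
    - cross (G x) (w x) (X x) (covariant G X Y x)
  = cross (G x) (w x) (covariant G X X x) (Y x).
Proof.
move=> Xs Ys.
have D (Z : 'rV[R]_7 -> 'rV[R]_7) : (forall k, smooth_on V (fun y => Z y 0 k)) -> forall m,
    is_der_row x (delta_mx 0 m) Z (\row_k partial m (fun y => Z y 0 k) x).
  by move=> Zs m r; rewrite mxE; apply: derivableP; exact: (Zs r [::] x ax).2.
apply/eqP; rewrite subr_eq; apply/eqP.
apply: (dot_nondeg (Gunit ax)) => z.
pose nX m := \row_k partial m (fun y => X y 0 k) x + X x *m conn m.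
pose nY m := \row_k partial m (fun y => Y y 0 k) x + Y x *m conn m.
have crs_suml (F : 'I_7 -> 'rV[R]_7) v : dot (G x) (crs (\sum_m X x 0 m *: F m) v) z
    = \sum_m X x 0 m * dot (G x) (crs (F m) v) z.
  have L : linear_form (fun u => dot (G x) (crs u v) z).
    by move=> c u u'; rewrite crs_linl dot_linl.
  by rewrite (linear_form_sum _ L); apply: eq_bigr => m _; exact: linear_formZ L.
have crs_sumr (F : 'I_7 -> 'rV[R]_7) u : dot (G x) (crs u (\sum_m X x 0 m *: F m)) z
    = \sum_m X x 0 m * dot (G x) (crs u (F m)) z.
  have L : linear_form (fun v => dot (G x) (crs u v) z).
    by move=> c v v'; rewrite crs_linr dot_linl.
  by rewrite (linear_form_sum _ L); apply: eq_bigr => m _; exact: linear_formZ L.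
rewrite !covariantE (linear_formD _ _ (dot_linl _ _)) crs_suml crs_sumr.
rewrite (linear_form_sum _ (dot_linl _ _)).
under eq_bigr => m _ do rewrite dotZl (cross_derivative (D X Xs m) (D Y Ys m)).2 2!mulrDr.
have : nabla_form (X x) (X x) (Y x) z = 0.
  by rewrite nabla_form_psi4; have := psiC12 (X x) (X x) (Y x) z; nra.
by rewrite /nabla_form => E; rewrite 2!big_split /= E add0r.
Qed.

End NearlyParallel.

End ChartNabla.

Theorem theorem3 (R : realType) (M : manifold R 7) (S : g2_structure M)
    (xi : vector_field M) :
  nearly_parallel S ->
  unit_field (g2_metric S) xi ->
  (geodesic_field (g2_metric S) xi <->
  almost_K_contact (g2_metric S) xi (induced_phi S xi) (induced_eta S xi)).
Proof.
move=> [k [dphi dstar]] xi1.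
have Gsym a x (ax : chart_img (atlas a) x) := rm_sym (g2_metric S) ax.
have Gunit a x : chart_img (atlas a) x -> g2_metric S a x \in unitmx.
  by move=> ax; apply: dot_pos_unit; exact: rm_pos.
have nabla_phi (X : vector_field M) a x : chart_img (atlas a) x ->
    covariant (g2_metric S a) (xi a) (fun y => induced_phi S xi a y (X a y)) x
      - induced_phi S xi a x (covariant (g2_metric S a) (xi a) (X a) x)
    = cross (g2_metric S a x) (g2_form S a x)
        (covariant (g2_metric S a) (xi a) (xi a) x) (X a x).
  move=> ax; apply: (@covariant_cross R M S a x ax k) => [y ay J|k0 J|j|j].
  - exact: dphi.
  - exact: dstar.
  - exact: vf_smooth.
  - exact: vf_smooth.
split=> [geo|[_ Kc] a x ax].
  split=> [a x ax|X a x ax]; last first.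
    by rewrite nabla_phi // geo // cross0l.
  have [A Aw] := g2_adapted S ax; have AG := g2_metricP ax Aw.
  have x1 := xi1 a x ax; split=> [v||u v]; rewrite /induced_phi /induced_eta.
  - rewrite (cross_crossr (Gsym _ _ ax) (Gunit _ _ ax) (df_alt (g2_form S) ax) Aw AG).
    by rewrite x1 scale1r addrC.
  - exact: x1.
  rewrite (cross_cross_dot (Gunit _ _ ax) Aw AG) x1 mul1r (dotC u (xi a x)) ?Gsym //.
  by rewrite mulrC.
have [A Aw] := g2_adapted S ax; have AG := g2_metricP ax Aw.
set n := covariant _ _ _ _.
have n_orth : dot (g2_metric S a x) n (xi a x) = 0.
  by apply: (unit_covariant_orth ax) => [j|y]; [exact: vf_smooth|exact: xi1].
(* The hypothesis is used with X = xi, where phi xi = 0. *)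
have : cross (g2_metric S a x) (g2_form S a x) (xi a x) n = 0.
  by rewrite (crossC _ _ _ (df_alt (g2_form S) ax)) -nabla_phi // Kc // oppr0.
move=> /(congr1 (cross (g2_metric S a x) (g2_form S a x) (xi a x))).
rewrite (cross_crossr (Gsym _ _ ax) (Gunit _ _ ax) (df_alt (g2_form S) ax) Aw AG) (xi1 a x ax).
rewrite (dotC _ _ (Gsym a x ax)) n_orth scale0r scale1r sub0r cross0r.
by move/eqP; rewrite oppr_eq0 => /eqP.
Qed.
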